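(* Let $r,f_1,\dots,f_n,g_1,\dots,g_n:\mathbb{R}^d\to\mathbb{R}\cup\{\infty\}$ be convex, closed, and proper. Assume $f_1,\dots,f_n$ are differentiable and have $L$-Lipschitz continuous gradients. Assume the Lagrangian $\mathcal{L}$ (defined in the context) has a saddle point, and let $0<\alpha<3/(2L)$. Let the iterates be generated by the stochastic method (S-PPG) of the context from an arbitrary (deterministic) starting point $\mathbf{z}^0\in\mathbb{R}^{dn}$. Then $\|p(\mathbf{z}^k)\|_2\to0$ with probability one, at the rate $$\min_{i=0,\dots,k}\mathbb{E}\|p(\mathbf{z}^i)\|_2^2\le\mathcal{O}(1/k).$$ Furthermore, with probability one, $\mathbf{z}^k\to\mathbf{z}^\star$, $x^{k+1/2}\to x^\star$, and $x_i^{k+1}\to x^\star$ for all $i=1,\dots,n$, where $\mathbf{z}^\star$ is some (random) fixed point of (S-PPG), i.e. $p(\mathbf{z}^\star)=0$, and $x^\star$ is some (random) solution of $\text{minimize}_{x\in\mathbb{R}^d}\; r(x)+\frac1n\sum_{i=1}^n(f_i(x)+g_i(x))$.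
   Context: For a convex, closed, proper $h$, $\mathrm{prox}_h(x_0)=\operatorname{argmin}_x\{h(x)+\frac12\|x-x_0\|_2^2\}$. Boldface denotes tuples of $n$ vectors of $\mathbb{R}^d$: $\mathbf{z}=(z_1,\dots,z_n)\in\mathbb{R}^{dn}$, $\bar z=\frac1n\sum_i z_i$. (S-PPG), with stepsize $\alpha>0$: at iteration $k$, $x^{k+1/2}=\mathrm{prox}_{\alpha r}\big(\frac1n\sum_{i=1}^n z_i^k\big)$; $i(k)$ is drawn uniformly from $\{1,\dots,n\}$, independently of the previous draws; $x_{i(k)}^{k+1}=\mathrm{prox}_{\alpha g_{i(k)}}\big(2x^{k+1/2}-z_{i(k)}^k-\alpha\nabla f_{i(k)}(x^{k+1/2})\big)$; $z_{i(k)}^{k+1}=z_{i(k)}^k+x_{i(k)}^{k+1}-x^{k+1/2}$ and $z_j^{k+1}=z_j^k$ for $j\ne i(k)$. For indices $i\neq i(k)$, $x_i^{k+1}$ denotes likewise $\mathrm{prox}_{\alpha g_i}\big(2x^{k+1/2}-z_i^k-\alpha\nabla f_i(x^{k+1/2})\big)$ (not needed to run the method). The mapping $p:\mathbb{R}^{dn}\to\mathbb{R}^{dn}$ is $(p(\mathbf{z}))_i=(1/\alpha)(x-x_i')$, where $x=\mathrm{prox}_{\alpha r}(\bar z)$ and $x_i'=\mathrm{prox}_{\alpha g_i}(2x-z_i-\alpha\nabla f_i(x))$. The Lagrangian is $\mathcal{L}(x,\mathbf{x},\boldsymbol{\nu})=r(x)+\frac1n\sum_{i=1}^n (f_i(x_i)+g_i(x_i))+\frac1n\sum_{i=1}^n\nu_i^T(x_i-x)$,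 for $x\in\mathbb{R}^d$, $\mathbf{x},\boldsymbol{\nu}\in\mathbb{R}^{dn}$; a saddle point is minimal in $(x,\mathbf{x})$ and maximal in $\boldsymbol{\nu}$. $\mathbb{E}$ is expectation over all draws $i(0),i(1),\dots$; $\mathcal{O}(\cdot)$ is as $k\to\infty$, with constants independent of $k$. *)

(* Defs.v *)
From HB Require Import structures.
From mathcomp Require Import all_boot all_order all_algebra.
From mathcomp Require Import all_classical all_reals all_analysis.

Set Implicit Arguments.
Unset Strict Implicit.
Unset Printing Implicit Defensive.

Import Order.TTheory GRing.Theory Num.Theory.
Import numFieldNormedType.Exports.

Local Open Scope classical_set_scope.
Local Open Scope ring_scope.

(* Vectors of R^d are row vectors 'rV[R]_d, and a tuple (z_1, ..., z_n) of
   vectors of R^d is the matrix 'M[R]_(n, d) whose rows are the z_i. *)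

Section Euclidean.
Context {R : realType}.

(* The library norm `|A| is the sup norm. For a tuple of vectors, norm2 is the
   Euclidean norm of R^(dn). *)
Definition norm2 m n (A : 'M[R]_(m, n)) : R :=
  Num.sqrt (\sum_i \sum_j A i j ^+ 2).

Definition dotp d (u v : 'rV[R]_d) : R := \sum_j u 0 j * v 0 j.

Definition tuple_mean n d (z : 'M[R]_(n, d)) : 'rV[R]_d :=
  n%:R^-1 *: \sum_(i < n) row i z.

End Euclidean.

Section ConvexAnalysis.
Context {R : realType} {d : nat}.
Implicit Types (h : 'rV[R]_d -> \bar R).

Definition econvex h := forall (x y : 'rV[R]_d) (t : R), 0 <= t <= 1 ->
  (h (t *: x + (1 - t) *: y)%R <= t%:E * h x + (1 - t)%:E * h y)%E.

Definition epigraph h : set ('rV[R]_d * R) := [set q | (h q.1 <= q.2%:E)%E].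

(* The first conjunct says that h takes its values in R \cup {+oo}. *)
Definition eproper h :=
  (forall x, h x != -oo%E) /\ (exists x, h x != +oo%E).

Definition ccp h := [/\ econvex h, closed (epigraph h) & eproper h].

(* Differentiability at every point of R^d includes finiteness everywhere. *)
Definition edifferentiable h := (forall x, h x \is a fin_num) /\
  (forall x, differentiable (fun y => fine (h y)) x).

Definition grad h (x : 'rV[R]_d) : 'rV[R]_d :=
  \row_j 'D_(delta_mx 0 j) (fun y => fine (h y)) x.

Definition lipschitz_grad (L : R) h :=
  forall x y, norm2 (grad h x - grad h y) <= L * norm2 (x - y).

Definition argmin h : set 'rV[R]_d := [set x | forall y, (h x <= h y)%E].

(* For a convex, closed, proper h the set of minimizers is a singleton, and
   get picks its element. *)
Definition prox h (x0 : 'rV[R]_d) : 'rV[R]_d :=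
  get (argmin (fun x => h x + (2^-1 * norm2 (x - x0) ^+ 2)%:E)%E).

End ConvexAnalysis.

Section SPPG.
Context {R : realType} {d n : nat}.
Variables (alpha : R) (r : 'rV[R]_d -> \bar R).
Variables (f g : 'I_n -> 'rV[R]_d -> \bar R).
Implicit Types (z : 'M[R]_(n, d)).

Definition objective (x : 'rV[R]_d) : \bar R :=
  (r x + n%:R^-1%:E * \sum_(i < n) (f i x + g i x))%E.

Definition lagrangian (x : 'rV[R]_d) (xs nu : 'M[R]_(n, d)) : \bar R :=
  (r x + n%:R^-1%:E * \sum_(i < n) (f i (row i xs) + g i (row i xs))
   + (n%:R^-1 * \sum_(i < n) dotp (row i nu) (row i xs - x))%:E)%E.

Definition saddle_point (x : 'rV[R]_d) (xs nu : 'M[R]_(n, d)) :=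
  (forall y ys, (lagrangian x xs nu <= lagrangian y ys nu)%E) /\
  (forall mu, (lagrangian x xs mu <= lagrangian x xs nu)%E).

(* x^{k+1/2}, as a function of z^k *)
Definition xhalf z : 'rV[R]_d :=
  prox (fun x => alpha%:E * r x)%E (tuple_mean z).

(* x_i^{k+1}, as a function of z^k *)
Definition xnext z (i : 'I_n) : 'rV[R]_d :=
  prox (fun x => alpha%:E * g i x)%E
    (2 *: xhalf z - row i z - alpha *: grad (f i) (xhalf z)).

Definition p_map z : 'M[R]_(n, d) :=
  \matrix_(i < n) (alpha^-1 *: (xhalf z - xnext z i)).

Definition sppg_step (i : 'I_n) z : 'M[R]_(n, d) :=
  \matrix_(j < n) (if j == i then row j z + xnext z j - xhalf z else row j z).

Fixpoint sppg (z0 : 'M[R]_(n, d)) (draw : nat -> 'I_n) (k : nat) :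
    'M[R]_(n, d) :=
  if k is k'.+1 then sppg_step (draw k') (sppg z0 draw k') else z0.

End SPPG.

Section Draws.
Context {disp : measure_display} {T : measurableType disp} {R : realType}.
Variable P : probability T R.

Definition uniform_draw n (I : T -> 'I_n) := forall i : 'I_n,
  measurable (I @^-1` [set i]) /\ P (I @^-1` [set i]) = n%:R^-1%:E.

Definition independent_draws n (I : nat -> T -> 'I_n) :=
  forall (J : seq nat) (A : nat -> set 'I_n), uniq J ->
    P (\bigcap_(k in [set` J]) (I k @^-1` A k)) =
    (\prod_(k <- J) P (I k @^-1` A k))%E.

End Draws.

(* Main.v *)
Require Import Defs.
From HB Require Import structures.
From mathcomp Require Import all_boot all_order all_algebra.
From mathcomp Require Import all_classical all_reals all_analysis.
From mathcomp Require Import measurable_realfun ring lra.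

Set Implicit Arguments.
Unset Strict Implicit.
Unset Printing Implicit Defensive.

Import Order.TTheory GRing.Theory Num.Theory.
Import numFieldNormedType.Exports.

Local Open Scope classical_set_scope.
Local Open Scope ring_scope.

(** The proof is a stochastic Fejer argument for the residual map p.

Writing the proximal steps through their optimality conditions (prox_subgrad)
and using the monotonicity of subdifferentials together with the
Baillon-Haddad inequality for the f i (cocoercive), one finds that p is
cocoercive: <p z - p z', z - z'> >= alpha (1 - alpha L / 4) |p z - p z'| ^ 2
(p_map_cocoercive). A step of the method replaces one uniformly chosen block
z_i by z_i - alpha p_i(z). Hence, for every zero zs of p, the mean over i of
|z^{k+1} - zs| ^ 2 is at most |z^k - zs| ^ 2 - kappa |p z^k| ^ 2, where
kappa = alpha ^ 2 (1 - alpha L / 2) / n is positive as alpha L < 2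
(sppg_step_descent). Saddle points provide zeros of p
(saddle_point_fixed_point), and zeros of p provide minimizers
(fixed_point_argmin).

Summing the expected decrease bounds the sum over k of E |p z^k| ^ 2, which
gives the rate and the almost sure convergence of p z^k to 0. For the iterates,
|z^k - zs| ^ 2 is a nonnegative supermartingale for each zs, and it almost
surely makes finitely many upcrossings from a level a to 2 a (ae_crossing). By
Fatou's lemma z^k is almost surely bounded along a subsequence, so it has a
cluster point, which is a zero of p by continuity. Almost surely the upcrossing
property holds for all zs in a countable dense set of zeros of p and all levels
1 / (i + 1); taking zs near the cluster point, one sees that z^k converges to it
(cvg_of_no_crossing). The half steps and the proximal steps converge by the
continuity of the proximal maps.

The state after k steps is a function of the first k draws. Their law is uniform
on sequences of length k, so all expectations are finite averages over
histories (integral_history), and the supermartingale arguments become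
inequalities between such averages (avg_potential). *)

(** * Euclidean geometry of vectors and of tuples of vectors *)

Section EuclideanGeometry.
Context {R : realType}.

Section DotProduct.
Context {d : nat}.
Implicit Types (u v w : 'rV[R]_d) (c : R).

Lemma dotpC u v : dotp u v = dotp v u.
Proof. by apply: eq_bigr => j _; rewrite mulrC. Qed.

Lemma dotpDl u v w : dotp (u + v) w = dotp u w + dotp v w.
Proof. by rewrite -big_split; apply: eq_bigr => j _ /=; rewrite mxE mulrDl. Qed.

Lemma dotpZl c u w : dotp (c *: u) w = c * dotp u w.
Proof. by rewrite mulr_sumr; apply: eq_bigr => j _ /=; rewrite mxE mulrA. Qed.

Lemma dotpNl u w : dotp (- u) w = - dotp u w.
Proof. by rewrite -scaleN1r dotpZl mulN1r. Qed.

Lemma dotpDr u v w : dotp w (u + v) = dotp w u + dotp w v.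
Proof. by rewrite dotpC dotpDl !(dotpC w). Qed.

Lemma dotpZr c u w : dotp w (c *: u) = c * dotp w u.
Proof. by rewrite dotpC dotpZl (dotpC w). Qed.

Lemma dotpNr u w : dotp w (- u) = - dotp w u.
Proof. by rewrite dotpC dotpNl (dotpC w). Qed.

Lemma dotp0l w : dotp 0 w = 0.
Proof. by apply: big1 => j _; rewrite mxE mul0r. Qed.

Lemma dotp_suml (J : Type) (s : seq J) (F : J -> 'rV[R]_d) w :
  dotp (\sum_(i <- s) F i) w = \sum_(i <- s) dotp (F i) w.
Proof.
by elim: s => [|i s IH]; rewrite ?big_nil ?dotp0l// !big_cons dotpDl IH.
Qed.

Definition dotpE := (dotpDl, dotpDr, dotpNl, dotpNr, dotpZl, dotpZr).

Lemma dotp_ge0 u : 0 <= dotp u u.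
Proof. by apply: sumr_ge0 => j _; rewrite -expr2 sqr_ge0. Qed.

Lemma dotp_eq0 u : dotp u u = 0 -> u = 0.
Proof.
move=> /eqP; rewrite psumr_eq0; last by move=> j _; rewrite -expr2 sqr_ge0.
move=> /allP u0; apply/rowP => j; rewrite mxE.
by have := u0 j (mem_index_enum _); rewrite -expr2 sqrf_eq0 => /eqP.
Qed.

Lemma norm2_sqr u : norm2 u ^+ 2 = dotp u u.
Proof.
rewrite /norm2 sqr_sqrtr; last first.
  by apply: sumr_ge0 => i _; apply: sumr_ge0 => j _; rewrite sqr_ge0.
by rewrite big_ord1; apply: eq_bigr => j _; rewrite expr2.
Qed.

End DotProduct.

Section Norm2.
Context {m n : nat}.
Implicit Types A B : 'M[R]_(m, n).

Lemma norm2_ge0 A : 0 <= norm2 A.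
Proof. exact: sqrtr_ge0. Qed.

Lemma norm2_sqr_rows A : norm2 A ^+ 2 = \sum_i dotp (row i A) (row i A).
Proof.
rewrite /norm2 sqr_sqrtr; last first.
  by apply: sumr_ge0 => i _; apply: sumr_ge0 => j _; rewrite sqr_ge0.
by apply: eq_bigr => i _; apply: eq_bigr => j _; rewrite mxE expr2.
Qed.

Lemma norm2_0 : norm2 (0 : 'M[R]_(m, n)) = 0.
Proof.
apply/eqP; rewrite -sqrf_eq0 norm2_sqr_rows big1// => i _.
by apply: big1 => j _; rewrite !mxE mul0r.
Qed.

Lemma norm2_eq0 A : norm2 A = 0 -> A = 0.
Proof.
move=> /eqP; rewrite -sqrf_eq0 norm2_sqr_rows psumr_eq0; last first.
  by move=> i _; exact: dotp_ge0.
move=> /allP A0; apply/row_matrixP => i; rewrite row0.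
by apply: dotp_eq0; apply/eqP; exact: A0 (mem_index_enum _).
Qed.

Lemma norm2N A : norm2 (- A) = norm2 A.
Proof.
apply/eqP; rewrite -(eqrXn2 (_ : 0 < 2)%N) ?norm2_ge0// !norm2_sqr_rows.
by apply/eqP/eq_bigr => i _; rewrite linearN /= dotpNl dotpNr opprK.
Qed.

Lemma norm2B A B : norm2 (A - B) = norm2 (B - A).
Proof. by rewrite -norm2N opprB. Qed.

Lemma ler_coord_norm2 A i j : `|A i j| <= norm2 A.
Proof.
rewrite -sqrtr_sqr ler_wsqrtr// (bigD1 i)//= (bigD1 j)//= -addrA lerDl.
by apply: addr_ge0; last (apply: sumr_ge0 => k _); apply: sumr_ge0 => l _;
  rewrite sqr_ge0.
Qed.

End Norm2.

Lemma cauchy_schwarz d (u v : 'rV[R]_d) : dotp u v <= norm2 u * norm2 v.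
Proof.
have [v0|v0] := eqVneq (norm2 v) 0.
  by rewrite (norm2_eq0 v0) dotpC dotp0l norm2_0 mulr0.
have [u0|u0] := eqVneq (norm2 u) 0.
  by rewrite (norm2_eq0 u0) dotp0l norm2_0 mul0r.
have p0 : 0 < norm2 u * norm2 v.
  by rewrite mulr_gt0// lt_neqAle eq_sym ?u0 ?v0 norm2_ge0.
have := dotp_ge0 (norm2 v *: u - norm2 u *: v).
rewrite !dotpE -!norm2_sqr (dotpC v u) => h.
rewrite -subr_ge0 -(pmulr_rge0 _ p0); lra.
Qed.

Lemma norm2_mxvec m n (A : 'M[R]_(m, n)) : norm2 (mxvec A) = norm2 A.
Proof.
rewrite /norm2 big_ord1; congr (Num.sqrt _).
rewrite pair_bigA /= (reindex _ (curry_mxvec_bij m n)) /=.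
by apply: eq_bigr => -[i j] _ /=; rewrite mxvecE.
Qed.

Lemma norm2_triangle m n (A B : 'M[R]_(m, n)) :
  norm2 (A + B) <= norm2 A + norm2 B.
Proof.
rewrite -ler_sqr ?nnegrE ?addr_ge0 ?norm2_ge0//.
rewrite -[norm2 (A + B)]norm2_mxvec -(norm2_mxvec A) -(norm2_mxvec B).
rewrite linearD /= norm2_sqr !dotpE sqrrD -!norm2_sqr.
have := cauchy_schwarz (mxvec A) (mxvec B).
by rewrite (dotpC (mxvec B)); lra.
Qed.

Lemma norm2Z m n c (A : 'M[R]_(m, n)) :
  norm2 (c *: A) = `|c| * norm2 A.
Proof.
apply/eqP; rewrite -(eqrXn2 (_ : 0 < 2)%N) ?mulr_ge0 ?norm2_ge0//.
rewrite exprMn !norm2_sqr_rows real_normK ?num_real// mulr_sumr.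
by apply/eqP/eq_bigr => i _; rewrite linearZ /= dotpZl dotpZr mulrA -expr2.
Qed.

(** The factor m * n + 1 is a crude comparison constant between the sup norm and
the Euclidean norm; the exact one is the square root of m * n. *)
Lemma norm2_le_coord m n (A : 'M[R]_(m, n)) (e : R) :
  (forall i j, `|A i j| <= e) -> 0 <= e -> norm2 A <= (m * n).+1%:R * e.
Proof.
move=> Ae e0.
rewrite -ler_sqr ?nnegrE ?norm2_ge0 ?mulr_ge0// norm2_sqr_rows.
apply: (@le_trans _ _ (\sum_(i < m) \sum_(j < n) e ^+ 2)).
  apply: ler_sum => i _; apply: ler_sum => j _; rewrite !mxE -expr2.
  by rewrite -real_normK ?num_real// ler_sqr ?nnegrE.
rewrite sumr_const card_ord sumr_const card_ord -mulrnA mulnC.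
rewrite -[e ^+ 2 *+ _]mulr_natl exprMn ler_wpM2r ?sqr_ge0// -natrX ler_nat.
by rewrite (leq_trans (leqnSn _))// -{1}[(m * n).+1]expn1 leq_pexp2l.
Qed.

Lemma rowB m n (A B : 'M[R]_(m, n)) i :
  row i (A - B) = row i A - row i B.
Proof. exact: linearB. Qed.

Lemma norm2_row_le m n (A : 'M[R]_(m, n)) i :
  norm2 (row i A) <= norm2 A.
Proof.
rewrite -ler_sqr ?nnegrE ?norm2_ge0// norm2_sqr norm2_sqr_rows.
by rewrite (bigD1 i)//= lerDl sumr_ge0// => j _; exact: dotp_ge0.
Qed.

Lemma norm2_tuple_mean_le n d (z : 'M[R]_(n, d)) :
  norm2 (tuple_mean z) <= norm2 z.
Proof.
have le_sum : norm2 (\sum_(i < n) row i z) <= n%:R * norm2 z.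
  apply: (@le_trans _ _ (\sum_(i < n) norm2 (row i z))).
    elim/big_rec2: _ => [|i x y _ xy]; first by rewrite norm2_0.
    by apply: le_trans (norm2_triangle _ _) _; rewrite lerD2l.
  apply: le_trans (ler_sum _ (fun i _ => norm2_row_le z i)) _.
  by rewrite sumr_const card_ord mulr_natl.
have [n0|n0] := eqVneq (n%:R : R) 0.
  by rewrite /tuple_mean n0 invr0 scale0r norm2_0 norm2_ge0.
rewrite /tuple_mean norm2Z ger0_norm ?invr_ge0// ler_pdivrMl//.
by rewrite lt_neqAle eq_sym n0/=.
Qed.

End EuclideanGeometry.

(** * Limits of matrices in the Euclidean norm *)

Section Topology.
Context {R : realType}.

Lemma continuous_norm2B m n (B : 'M[R]_(m, n)) :
  continuous (fun A : 'M[R]_(m, n) => norm2 (A - B)).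
Proof.
have -> : (fun A : 'M[R]_(m, n) => norm2 (A - B)) =
    (fun A => Num.sqrt (\sum_i \sum_j (A i j - B i j) ^+ 2)).
  apply/funext => A; congr Num.sqrt.
  by apply: eq_bigr => i _; apply: eq_bigr => j _; rewrite !mxE.
move=> A; apply: continuous_comp; last exact: sqrt_continuous.
apply: cvg_big => [||i _]; first exact: add_continuous.
  exact: nbhs_filter.
apply: cvg_big => [||j _]; first exact: add_continuous.
  exact: nbhs_filter.
apply: (@continuous_comp _ _ _ (fun C : 'M[R]_(m, n) => C i j - B i j)
  (fun x => x ^+ 2)); last exact: exprn_continuous.
have FA : Filter (nbhs A) by exact: nbhs_filter.
by apply: cvgB; [exact: coord_continuous|exact: cvg_cst].
Qed.

Lemma mx_norm_le_norm2 m n (A : 'M[R]_(m, n)) : `|A| <= norm2 A.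
Proof.
rewrite [leLHS]/Num.norm /= mx_normrE; apply/bigmax_leP; split.
  exact: norm2_ge0.
by move=> /= [i j] _; exact: ler_coord_norm2.
Qed.

Lemma compact_norm2_ball d (c : 'rV[R]_d) (rho : R) :
  compact [set x | norm2 (x - c) <= rho].
Proof.
apply: bounded_closed_compact.
  exists (rho + norm2 c); split; first exact: num_real.
  move=> M /ltW rM x /= xc; apply: le_trans rM.
  rewrite -[x](subrK c); apply: le_trans (mx_norm_le_norm2 _) _.
  by apply: le_trans (norm2_triangle _ _) _; rewrite lerD2r.
have /continuous_closedP := @continuous_norm2B 1 d c.
by move=> /(_ _ (@closed_le R rho)).
Qed.

Lemma cvg_mx_of_norm2 m n (u : nat -> 'M[R]_(m, n)) l :
  norm2 (u k - l) @[k --> \oo] --> (0 : R) -> u k @[k --> \oo] --> l.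
Proof.
move=> u0; apply/cvgrPdist_lt => e e0.
have [N _ hN] := (cvgr0Pnorm_lt _).1 u0 e e0; exists N => // k /hN /=.
rewrite ger0_norm ?norm2_ge0// norm2B.
exact: le_lt_trans (mx_norm_le_norm2 _).
Qed.

Lemma cvg_coord_of_norm2 m n (u : nat -> 'M[R]_(m, n)) l i j :
  norm2 (u k - l) @[k --> \oo] --> (0 : R) -> u k i j @[k --> \oo] --> l i j.
Proof.
move=> u0; apply/cvgrPdist_lt => e e0.
have [N _ hN] := (cvgr0Pnorm_lt _).1 u0 e e0; exists N => // k /hN /=.
rewrite ger0_norm ?norm2_ge0// norm2B.
by apply: le_lt_trans; have := ler_coord_norm2 (l - u k) i j; rewrite !mxE.
Qed.

Lemma cvg_norm2_lipschitz m n m' n' (F : 'M[R]_(m, n) -> 'M[R]_(m', n')) K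
    (u : nat -> 'M[R]_(m, n)) l :
  (forall x y, norm2 (F x - F y) <= K * norm2 (x - y)) ->
  norm2 (u k - l) @[k --> \oo] --> (0 : R) ->
  norm2 (F (u k) - F l) @[k --> \oo] --> (0 : R).
Proof.
move=> lip u0; apply: (squeeze_cvgr (f := fun=> 0)
  (h := fun k => K * norm2 (u k - l))).
- by apply: nearW => k; rewrite norm2_ge0 lip.
- exact: cvg_cst.
- by rewrite -(mulr0 K); apply: cvgM => //; exact: cvg_cst.
Qed.

(** Bolzano-Weierstrass for a sequence that is only bounded along a subsequence;
mxvec, an isometry, transports the compactness of balls of row vectors. *)
Lemma frequently_bounded_cluster m n (u : nat -> 'M[R]_(m, n)) c (B : R) :
  (forall M, exists2 k, (M <= k)%N & norm2 (u k - c) <= B) ->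
  exists l, forall e, 0 < e -> forall M, exists2 k, (M <= k)%N & norm2 (u k - l) < e.
Proof.
move=> uB.
pose K := [set x : 'rV[R]_(m * n) | norm2 (x - mxvec c) <= B].
pose S M := [set x | K x /\ exists2 k, (M <= k)%N & x = mxvec (u k)].
have FF : ProperFilter (filter_from setT S).
  apply: filter_from_proper; last first.
    move=> M _; have [k Mk kB] := uB M; exists (mxvec (u k)); split; last by exists k.
    by rewrite /K /= -linearB norm2_mxvec.
  apply: filter_from_filter; first by exists 0%N.
  move=> i j _ _; exists (maxn i j) => // x [Kx [k]].
  by rewrite geq_max => /andP[ik jk] xE; split; split => //; exists k.
have [|x [Kx clx]] := @compact_norm2_ball _ (mxvec c) B _ FF.
  by exists 0%N => // x [].
exists (vec_mx x) => e e0 M.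
have nx : nbhs x [set y | norm2 (y - x) < e].
  have : nbhs (norm2 (x - x)) [set t : R | t < e].
    by rewrite subrr norm2_0; exact: lt_nbhsl.
  exact: (@continuous_norm2B _ _ x x).
have SM : filter_from setT S (S M) by exists M.
have [y [[_ [k Mk yE]] /= yx]] := clx _ _ SM nx.
by exists k => //; rewrite -norm2_mxvec linearB /= vec_mxK -yE.
Qed.

End Topology.

(** * Convex functions with Lipschitz gradient *)

Section SmoothConvex.
Context {R : realType} {d : nat}.
Variables (h : 'rV[R]_d -> \bar R) (L : R).
Hypotheses (hdiff : edifferentiable h) (hlip : lipschitz_grad L h).

Let F (x : 'rV[R]_d) : R := fine (h x).

Lemma edifferentiable_fin x : h x = (F x)%:E.
Proof. by rewrite fineK//; case: hdiff => + _; apply. Qed.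

Lemma derive_dotp_grad x w : 'D_w F x = dotp (grad h x) w.
Proof.
have dF : differentiable F x by case: hdiff => _; apply.
rewrite deriveE// {1}(row_sum_delta w) linear_sum; apply: eq_bigr => j _.
by rewrite linearZ /= -deriveE// mxE mulrC.
Qed.

Lemma is_derive_line x w (t : R) :
  is_derive t 1 (fun s : R => F (x + s *: w)) (dotp (grad h (x + t *: w)) w).
Proof.
have dF : differentiable F (x + t *: w) by case: hdiff => _; apply.
have E : (fun s : R => s^-1 *: (((fun s : R => F (x + s *: w)) \o shift t) (s *: 1)
             - F (x + t *: w)))
       = (fun s : R => s^-1 *: ((F \o shift (x + t *: w)) (s *: w)
             - F (x + t *: w))).
  apply/funext => s /=; congr (_ *: (F _ - _)).
  by rewrite [s *: 1]mulr1 scalerDl addrCA addrA.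
split; first by rewrite /derivable E; exact: diff_derivable.
by rewrite -derive_dotp_grad /derive E.
Qed.

(** The mean value theorem for s |-> F (x + s w) + c s ^ 2. With
c = -+ L / 2 * |w| ^ 2 the derivative of the quadratic term absorbs the
Lipschitz error of the gradient at the unknown point s, which yields the sharp
constant L / 2 of the descent lemma without integration. *)
Lemma mean_value_quadratic x w (c : R) :
  exists2 s : R, 0 < s < 1 &
    F (x + w) - F x + c = dotp (grad h (x + s *: w)) w + 2 * s * c.
Proof.
pose phi := (fun s : R => F (x + s *: w)) + c \*: (id ^+ 2 : R -> R).
pose dphi (s : R) :=
  dotp (grad h (x + s *: w)) w + c *: ((2%:R * s ^+ 1) *: 1) : R.
have phiP (s : R) : is_derive s 1 phi (dphi s).
  apply: is_deriveD; first exact: is_derive_line.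
have cphi : {within `[0, 1], continuous phi}.
  by apply: derivable_within_continuous => s _; case: (phiP s).
have [s s01] := MVT ltr01 (fun s _ => phiP s) cphi.
have phiE (u : R) : phi u = F (x + u *: w) + c * u ^+ 2 by rewrite /phi !fctE.
rewrite !phiE subr0 scale1r scale0r addr0 /dphi /GRing.scale /= => E.
exists s; first by move: s01; rewrite in_itv.
by move: E; rewrite /GRing.scale /=; lra.
Qed.

Lemma grad_lip_dotp x w (s : R) : 0 <= s ->
  `|dotp (grad h (x + s *: w) - grad h x) w| <= s * (L * norm2 w ^+ 2).
Proof.
move=> s0.
have B (g : 'rV[R]_d) : norm2 g <= s * L * norm2 w ->
    dotp g w <= s * (L * norm2 w ^+ 2).
  move=> gB; apply: le_trans (cauchy_schwarz _ _) _.
  by rewrite expr2 !mulrA ler_wpM2r ?norm2_ge0.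
have G : norm2 (grad h (x + s *: w) - grad h x) <= s * L * norm2 w.
  apply: le_trans (hlip _ _) _; rewrite addrC addKr.
  have -> : norm2 (s *: w) = s * norm2 w.
    apply/eqP; rewrite -(eqrXn2 (_ : 0 < 2)%N) ?mulr_ge0 ?norm2_ge0//.
    by rewrite exprMn !norm2_sqr !dotpE mulrA expr2.
  by rewrite mulrCA mulrA.
by rewrite ler_norml lerNl -dotpNl !B// norm2N.
Qed.

Lemma descent x w :
  F (x + w) <= F x + dotp (grad h x) w + L / 2 * norm2 w ^+ 2.
Proof.
have [s /andP[s0 s1]] := mean_value_quadratic x w (- (L / 2 * norm2 w ^+ 2)).
have := grad_lip_dotp x w (ltW s0).
by rewrite ler_norml dotpDl dotpNl => /andP[_ ub]; lra.
Qed.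

Lemma ascent x w :
  F x + dotp (grad h x) w - L / 2 * norm2 w ^+ 2 <= F (x + w).
Proof.
have [s /andP[s0 s1]] := mean_value_quadratic x w (L / 2 * norm2 w ^+ 2).
have := grad_lip_dotp x w (ltW s0).
by rewrite ler_norml dotpDl dotpNl => /andP[lb _]; lra.
Qed.

End SmoothConvex.

(** Division by t and passage to the limit t -> 0; this replaces one-sided
directional derivatives in every first-order argument below. *)
Lemma le_of_quadratic_error (R : realFieldType) (a b c : R) :
  (forall t, 0 < t <= 1 -> t * a <= t * b + t ^+ 2 * c) -> a <= b.
Proof.
move=> H; rewrite leNgt; apply/negP => ab.
pose K := `|c| + (a - b).
have K0 : 0 < K by rewrite ltr_wpDl// subr_gt0.
pose t := (a - b) / (2 * K).
have t0 : 0 < t by rewrite divr_gt0 ?subr_gt0// mulr_gt0.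
have t1 : t <= 1.
  by rewrite ler_pdivrMr ?mulr_gt0// mul1r; rewrite /K; have := normr_ge0 c; lra.
have := H t; rewrite t0 t1 => /(_ isT).
rewrite expr2 -mulrA -mulrDr ler_pM2l// => ineq.
have cK : t * c <= t * K.
  by rewrite ler_pM2l// /K; have := ler_norm c; lra.
have : t * K = (a - b) / 2 by rewrite /t; field; rewrite gt_eqF.
lra.
Qed.

Section Cocoercive.
Context {R : realType} {d : nat}.
Variables (h : 'rV[R]_d -> \bar R) (L : R).
Hypotheses (hL : 0 < L) (hconv : econvex h).
Hypotheses (hdiff : edifferentiable h) (hlip : lipschitz_grad L h).

Let F (x : 'rV[R]_d) : R := fine (h x).

Lemma grad_le x w : F x + dotp (grad h x) w <= F (x + w).
Proof.
rewrite -lerBrDl.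
apply: (@le_of_quadratic_error _ _ _ (L / 2 * norm2 w ^+ 2)) => t /andP[t0 t1].
have := ascent hdiff hlip x (t *: w).
rewrite -/(F x) -/(F (_ + _)) norm2_sqr !dotpE -norm2_sqr => asc.
have := hconv (x + w) x (t := t); rewrite (ltW t0) t1 => /(_ isT).
have -> : t *: (x + w) + (1 - t) *: x = x + t *: w.
  by apply/rowP => j; rewrite !mxE; ring.
have hE y : h y = (F y)%:E := edifferentiable_fin hdiff y.
rewrite !hE -!EFinM -EFinD lee_fin.
lra.
Qed.

(** The function F - <grad F x, .> is minimal at x. Its value there is compared with
its value after a gradient step of length 1 / L from y, which the descent lemma
bounds from above. *)
Lemma cocoercive_half x y :
  F x + dotp (grad h x) (y - x)
    + (2 * L)^-1 * norm2 (grad h y - grad h x) ^+ 2 <= F y.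
Proof.
have [g gE] : exists g, grad h y = grad h x + g.
  by exists (grad h y - grad h x); rewrite addrC subrK.
rewrite gE (addrC (grad h x)) addrK.
have := grad_le x (y - x - L^-1 *: g).
have := descent hdiff hlip y (- (L^-1 *: g)).
have -> : x + (y - x - L^-1 *: g) = y - L^-1 *: g.
  by apply/rowP => j; rewrite !mxE; ring.
rewrite -/(F y) -/(F (_ - _)); set Fz := F (y - _).
rewrite gE norm2_sqr !dotpE !norm2_sqr => h1 h2.
have L0 : L != 0 by rewrite gt_eqF.
have : L / 2 * (- (L^-1 * - (L^-1 * dotp g g))) = L^-1 * dotp g g / 2 by field.
have -> : (2 * L)^-1 = L^-1 / 2 by field.
lra.
Qed.

(** The Baillon-Haddad inequality: the two half inequalities for (x, y) and (y, x)
are added. *)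
Lemma cocoercive x y :
  norm2 (grad h x - grad h y) ^+ 2 <= L * dotp (grad h x - grad h y) (x - y).
Proof.
have := cocoercive_half x y; have := cocoercive_half y x.
rewrite (norm2B (grad h y)) -(opprB x y) dotpNr (dotpDl (grad h x)) dotpNl.
set N := _ ^+ 2 => h1 h2.
have L2 : L^-1 = 2 * (2 * L)^-1 by field; rewrite gt_eqF.
have : L^-1 * N <= dotp (grad h x) (x - y) - dotp (grad h y) (x - y).
  by rewrite L2; lra.
by rewrite ler_pdivrMl.
Qed.

End Cocoercive.

(** * Subgradients and proximal maps *)

(** The nonempty sublevel sets of psi on K form a filter base of closed sets; a
cluster point of that filter lies in all of them. *)
Lemma lsc_argmin_compact (R : realType) (X : topologicalType) (K : set X)
    (psi : X -> \bar R) :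
  compact K -> (forall c : R, closed [set x | (psi x <= c%:E)%E]) ->
  (forall x, psi x != -oo%E) -> K !=set0 ->
  exists2 x, K x & forall y, K y -> (psi x <= psi y)%E.
Proof.
move=> cK clpsi psiN [x0 Kx0].
pose D := [set c : R | exists2 y, K y & (psi y <= c%:E)%E].
pose B (c : R) := K `&` [set x | (psi x <= c%:E)%E].
have [[c0 Dc0]|D0] := pselect (D !=set0); last first.
  exists x0 => // y Ky; suff -> : psi y = +oo%E by exact: leey.
  move: (psiN y); case E : (psi y) => [c| |]// _.
  by exfalso; apply: D0; exists c; exists y => //; rewrite E.
have FF : ProperFilter (filter_from D B).
  apply: filter_from_proper; last by move=> c [y Ky yc]; exists y.
  apply: filter_from_filter; first by exists c0.
  move=> i j [y Ky yi] [w Kw wj]; have [ij|/ltW ji] := leP i j.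
    exists i; first by exists y.
    by move=> x [Kx xi]; split; split => //=; apply: le_trans xi _; rewrite lee_fin.
  exists j; first by exists w.
  by move=> x [Kx xj]; split; split => //=; apply: le_trans xj _; rewrite lee_fin.
have [|x [Kx clx]] := cK _ FF; first by exists c0 => // x [].
exists x => // y Ky; move: (psiN y); case E : (psi y) => [c| |]// _.
  apply: (clpsi c); move=> U Ux.
  have Fc : filter_from D B (B c) by exists c => //; exists y; rewrite ?E.
  by have [w [[_ ?] ?]] := clx _ _ Fc Ux; exists w.
exact: leey.
Qed.

(** Finiteness at x is part of the definition: it is what turns the inequalities
between extended reals into inequalities between reals in the sequel. *)
Definition subgrad {R : realType} {d} (h : 'rV[R]_d -> \bar R)
    (x u : 'rV[R]_d) :=
  h x \is a fin_num /\ forall y, (h x + (dotp u (y - x))%:E <= h y)%E.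

Section ProximalOperator.
Context {R : realType} {d : nat}.
Implicit Types (h : 'rV[R]_d -> \bar R) (x y u v : 'rV[R]_d).

Lemma subgrad_monotone h x y u v :
  subgrad h x u -> subgrad h y v -> 0 <= dotp (u - v) (x - y).
Proof.
move=> [/fineK hx hu] [/fineK hy hv]; have := hu y; have := hv x.
rewrite -hx -hy -!EFinD !lee_fin -(opprB x y) dotpDl !dotpNl dotpNr; lra.
Qed.

Lemma ccp_scale a h : 0 < a -> ccp h -> ccp (fun x => a%:E * h x)%E.
Proof.
move=> a0 [hconv hcl [hN [x1 hx1]]].
have aN x : (a%:E * h x)%E != -oo%E.
  by move: (hN x); case: (h x) => [c| |]//; rewrite gt0_muley.
split; last (split => //; exists x1); last first.
  by move: hx1 (hN x1); case: (h x1).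
- rewrite (_ : epigraph _ = (fun q : 'rV[R]_d * R => (q.1, a^-1 * q.2)) @^-1`
      epigraph h); last first.
    apply/seteqP; split => -[x t]; rewrite /epigraph /=;
    by rewrite EFinM lee_pdivlMl.
  apply: preimage_closed => // q _.
  apply: (@cvg_pair _ _ _ (nbhs q) (nbhs q.1) (nbhs (a^-1 * q.2))).
    exact: cvg_fst.
  by apply: cvgMl_tmp; exact: cvg_snd.
- move=> x y t t01; have := hconv x y t t01.
  move/(lee_wpmul2l (_ : 0 <= a%:E)%E) => /(_ (ltW a0)) /le_trans; apply.
  have mN s z : 0 <= s -> (-oo < s%:E * h z)%E.
    move=> s0; move: (hN z); case: (h z) => [c| |]// _; first exact: ltNyr.
    move: s0; rewrite le_eqVlt => /predU1P[<-|s0]; first by rewrite mul0e.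
    by rewrite gt0_muley.
  case/andP: t01 => t0 t1; rewrite muleDr//; last first.
    by apply: ltninfty_adde_def; rewrite inE mN// subr_ge0.
  by rewrite !muleA !(muleC a%:E).
Qed.

Section Prox.
Variable h : 'rV[R]_d -> \bar R.
Hypothesis hccp : ccp h.

(** A substitute for an affine minorant that needs no separation theorem: h has a
minimum m on the unit ball around a point x1 of its domain, and a point at
distance s > 1 from x1 is seen from x1 through the sphere of that ball, so
convexity makes h decrease at most linearly in s. *)
Lemma convex_linear_lower_bound :
  exists (x1 : 'rV[R]_d) (H m : R), [/\ h x1 = H%:E, m <= H &
    forall x, ((m - (H - m) * norm2 (x - x1))%:E <= h x)%E].
Proof.
have [hconv hcl [hN [x1 hx1]]] := hccp.
case E1 : (h x1) => [H| |]; [|by rewrite E1 in hx1|by move: (hN x1); rewrite E1].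
have hsub (c : R) : closed [set x | (h x <= c%:E)%E].
  apply: (@preimage_closed _ _ (fun x => (x, c)) (epigraph h)) => //.
  move=> x _; apply: (@cvg_pair _ _ _ (nbhs x) (nbhs x) (nbhs c)).
    exact: cvg_id.
  exact: cvg_cst.
have Bx1 : norm2 (x1 - x1) <= 1 by rewrite subrr norm2_0.
have [|x2 _ x2min] := lsc_argmin_compact (@compact_norm2_ball _ _ x1 1) hsub hN.
  by exists x1.
have := x2min _ Bx1; rewrite E1.
case E2 : (h x2) => [m| |]; [|by []|by move: (hN x2); rewrite E2].
rewrite lee_fin => mH; exists x1, H, m; split => // x.
have n0 : 0 <= (H - m) * norm2 (x - x1) by rewrite mulr_ge0 ?norm2_ge0 ?subr_ge0.
have [xB|xB] := leP (norm2 (x - x1)) 1.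
  by apply: le_trans (x2min _ xB); rewrite E2 lee_fin; lra.
case E : (h x) => [a| |]; [|exact: leey|by move: (hN x); rewrite E].
set t := norm2 (x - x1) in xB n0 *.
have t0 : 0 < t by lra.
have ti1 : t^-1 <= 1 by rewrite invf_le1//; lra.
have := hconv x x1 t^-1; rewrite ti1 invr_ge0 (ltW t0) => /(_ isT).
have /x2min : norm2 (t^-1 *: x + (1 - t^-1) *: x1 - x1) <= 1.
  have -> : t^-1 *: x + (1 - t^-1) *: x1 - x1 = t^-1 *: (x - x1).
    by apply/rowP => j; rewrite !mxE; ring.
  rewrite -(ler_sqr (norm2_ge0 _)) ?nnegrE// norm2_sqr dotpZl dotpZr -norm2_sqr.
  rewrite expr1n -/t (_ : _ * _ = 1)//.
  by field; rewrite gt_eqF.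
rewrite E1 E2 E => /le_trans /[apply].
rewrite -!EFinM -EFinD !lee_fin => ineq.
have : t * m <= t * (t^-1 * a + (1 - t^-1) * H) by rewrite ler_pM2l.
have -> : t * (t^-1 * a + (1 - t^-1) * H) = a + t * H - H.
  by field; rewrite gt_eqF.
lra.
Qed.

(** The quadratic term beats the linear lower bound of h, so outside a large ball
the objective exceeds its value at x1, and inside it lower semicontinuity
applies. *)
Lemma prox_argmin_nonempty x0 :
  argmin (fun x => h x + (2^-1 * norm2 (x - x0) ^+ 2)%:E)%E !=set0.
Proof.
have [x1 [H [m [hx1 mH lb]]]] := convex_linear_lower_bound.
have [hconv hcl [hN _]] := hccp.
set phi := (X in argmin X).
have phiN x : phi x != -oo%E.
  by rewrite /phi; move: (hN x); case: (h x).
have phicl (c : R) : closed [set x | (phi x <= c%:E)%E].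
  rewrite (_ : mkset _ =
      (fun x => (x, c - 2^-1 * norm2 (x - x0) ^+ 2)) @^-1` epigraph h); last first.
    by apply/seteqP; split=> x; rewrite /phi /epigraph /= EFinB leeBrDr.
  apply: preimage_closed => // x _.
  apply: (@cvg_pair _ _ _ (nbhs x) (nbhs x)
    (nbhs (c - 2^-1 * norm2 (x - x0) ^+ 2))); first exact: cvg_id.
  apply: cvgB; [exact: cvg_cst|apply: cvgMl_tmp].
  apply: (@continuous_comp _ _ _ (fun x => norm2 (x - x0)) (fun s => s ^+ 2));
    last exact: exprn_continuous.
  exact: continuous_norm2B.
pose D := norm2 (x1 - x0).
pose k := H - m.
pose c0 := H + 2^-1 * D ^+ 2.
pose A := c0 - m + k * D.
(* At distance s > rho one has s >= 1 and s / 2 - k >= A + 1, so that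
   s ^ 2 / 2 - k s exceeds A; this is what the lower bound requires. *)
pose rho := 2 * k + 2 * A + 2.
have D0 : 0 <= D by exact: norm2_ge0.
have D20 : 0 <= D ^+ 2 by exact: sqr_ge0.
have k0 : 0 <= k by rewrite subr_ge0.
have kD : 0 <= k * D by exact: mulr_ge0.
have A0 : 0 <= A by rewrite /A /c0; lra.
have phix1 : phi x1 = c0%:E by rewrite /phi hx1 -EFinD.
have far x : rho < norm2 (x - x0) -> (c0%:E < phi x)%E.
  set s := norm2 (x - x0) => rs.
  apply: (@lt_le_trans _ _ (m - (H - m) * norm2 (x - x1) + 2^-1 * s ^+ 2)%:E).
    have tri : norm2 (x - x1) <= s + D.
      rewrite /D (norm2B x1); apply: le_trans (norm2_triangle _ _).
      by rewrite addrA subrK.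
    have k1 : (H - m) * norm2 (x - x1) <= k * s + k * D.
      by rewrite -mulrDr ler_wpM2l.
    have s1 : 1 * (A + 1) <= s * (s / 2 - k).
      move: rs; rewrite /rho => rs; apply: ler_pM => /=; lra.
    move: s1; rewrite lte_fin {1}/A.
    by rewrite mulrBr (mulrC s k) mulrA -expr2; lra.
  by rewrite EFinD leeD2r// lb.
have [|x Kx xmin] := lsc_argmin_compact (@compact_norm2_ball _ _ x0 rho) phicl phiN.
  by exists x0; rewrite /= subrr norm2_0 /rho; lra.
exists x => y; have [yK|yK] := leP (norm2 (y - x0)) rho; first exact: xmin.
apply: le_trans (ltW (far _ yK)); rewrite -phix1; apply: xmin => /=.
by rewrite leNgt; apply/negP => /far; rewrite phix1 ltxx.
Qed.

End Prox.

(** First-order optimality, obtained by comparing the minimizer x with points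
t y + (1 - t) x: the quadratic term contributes an error of order t ^ 2 only. *)
Lemma prox_subgrad a h x0 : 0 < a -> ccp h ->
  let x := prox (fun y => a%:E * h y)%E x0 in subgrad h x (a^-1 *: (x0 - x)).
Proof.
move=> a0 hccp; have ahccp := ccp_scale a0 hccp.
have [hconv _ [hN [x1 hx1]]] := hccp.
have := getPex (prox_argmin_nonempty ahccp x0).
rewrite -/(prox _ _); set x := prox _ _ => xmin /=.
have hxfin : h x \is a fin_num.
  have := xmin x1; move: hx1 (hN x1) (hN x).
  by case: (h x1) => // c1 _ _; case: (h x) => //; rewrite gt0_muley.
split=> // y; move: (hN y); case E : (h y) => [b| |]// _; last exact: leey.
have [p hxE] : exists p, h x = p%:E by exists (fine (h x)); rewrite fineK.
rewrite hxE -EFinD lee_fin.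
suff : dotp (x0 - x) (y - x) <= a * (b - p).
  by rewrite dotpZl -lerBrDl ler_pdivrMl.
apply: (@le_of_quadratic_error _ _ _ (2^-1 * norm2 (y - x) ^+ 2)).
move=> t /[dup] t01 /andP[t0 t1].
have := hconv y x t; rewrite (ltW t0) t1 => /(_ isT).
have := xmin (t *: y + (1 - t) *: x).
rewrite E hxE; case: (h _) (hN (t *: y + (1 - t) *: x)) => [c| |]// _.
rewrite -!EFinM -!EFinD !lee_fin !norm2_sqr.
have -> : t *: y + (1 - t) *: x - x0 = t *: (y - x) - (x0 - x).
  by apply/rowP => j; rewrite !mxE; ring.
rewrite -(opprB x0 x); move: (x0 - x) (y - x) => u w.
rewrite !dotpE (dotpC w u) => h1 /(ler_wpM2l (ltW a0)).
by move: h1; lra.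
Qed.

(** The optimality condition determines the proximal point, because two solutions
would contradict the monotonicity of the subdifferential. *)
Lemma subgrad_prox a h x0 x : 0 < a -> ccp h ->
  subgrad h x (a^-1 *: (x0 - x)) -> prox (fun y => a%:E * h y)%E x0 = x.
Proof.
move=> a0 hccp hx; have := prox_subgrad x0 a0 hccp; set y := prox _ _ => hy.
have := subgrad_monotone hy hx.
have -> : a^-1 *: (x0 - y) - a^-1 *: (x0 - x) = - (a^-1 *: (y - x)).
  by apply/rowP => j; rewrite !mxE; ring.
rewrite dotpNl dotpZl oppr_ge0 pmulr_rle0 ?invr_gt0// => le0.
apply/eqP; rewrite -subr_eq0; apply/eqP/dotp_eq0/eqP.
by rewrite eq_le le0 dotp_ge0.
Qed.

End ProximalOperator.

(** * The residual map and its cocoercivity *)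

(** The operators xh, xn, p and step stand for the half step, the proximal steps on
the g i, the residual p and the update of one block. They enter only through
their optimality conditions, and as variables they cannot be unfolded down to
the choice of a minimizer. *)
Section FixedPointOperator.
Context {R : realType} {d n : nat}.
Hypothesis hn : (0 < n)%N.
Variables (r : 'rV[R]_d -> \bar R) (f g : 'I_n -> 'rV[R]_d -> \bar R).
Variables (L alpha : R).
Hypotheses (hL : 0 < L) (alpha_gt0 : 0 < alpha).
Hypotheses (hfconv : forall i, econvex (f i)).
Hypotheses (hfdiff : forall i, edifferentiable (f i)).
Hypothesis hflip : forall i, lipschitz_grad L (f i).

Variables (xh : 'M[R]_(n, d) -> 'rV[R]_d) (xn : 'M[R]_(n, d) -> 'I_n -> 'rV[R]_d).
Hypothesis xh_subgrad : forall z,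
  subgrad r (xh z) (alpha^-1 *: (tuple_mean z - xh z)).
Hypothesis xn_subgrad : forall z i, subgrad (g i) (xn z i)
  (alpha^-1 *: (2 *: xh z - row i z - alpha *: grad (f i) (xh z) - xn z i)).

Variables (p : 'M[R]_(n, d) -> 'M[R]_(n, d)).
Hypothesis row_p : forall z i, row i (p z) = alpha^-1 *: (xh z - xn z i).

Variable step : 'I_n -> 'M[R]_(n, d) -> 'M[R]_(n, d).
Hypothesis row_step : forall i z j,
  row j (step i z) = if j == i then row j z - alpha *: row j (p z) else row j z.

(** One block of the cocoercivity estimate; a, b, q and zeta are the differences, for
two points z and z', of the half steps, the proximal steps, the gradients and
the blocks. After the monotonicity of the subdifferential has removed the inner
product of b and zeta, the gap between the two sides is at least alpha / L times
the squared norm of q - (L / 2) (a - b). *)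
Lemma cocoercive_row (a b q zeta : 'rV[R]_d) :
  0 <= dotp (2 *: a - zeta - alpha *: q - b) b ->
  norm2 q ^+ 2 <= L * dotp q a ->
  dotp a zeta - dotp a a + (1 - alpha * L / 4) * dotp (a - b) (a - b)
    <= dotp (a - b) zeta.
Proof.
rewrite norm2_sqr => mono coco.
have sq := dotp_ge0 (q - (L / 2) *: (a - b)).
have : 0 <= alpha * (dotp q b + L / 4 * dotp (a - b) (a - b)).
  rewrite mulr_ge0 ?(ltW alpha_gt0)// -(pmulr_rge0 _ hL).
  move: sq coco; rewrite !dotpE !(dotpC a q) !(dotpC b q) (dotpC b a); lra.
move: mono; rewrite !dotpE !(dotpC b a) !(dotpC zeta b); lra.
Qed.

(** Summation of the block estimates. The terms that do not involve p have a
nonnegative sum by the monotonicity of the subdifferential of r, because the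
half step depends on z through the mean of its blocks. *)
Lemma p_map_cocoercive z z' :
  alpha * (1 - alpha * L / 4) * norm2 (p z - p z') ^+ 2 <=
  \sum_i dotp (row i (p z - p z')) (row i (z - z')).
Proof.
pose a := xh z - xh z'.
pose b i := xn z i - xn z' i.
pose q i := grad (f i) (xh z) - grad (f i) (xh z').
have rowE i : row i (p z - p z') = alpha^-1 *: (a - b i).
  by rewrite rowB !row_p; apply/rowP => j; rewrite !mxE; ring.
have main i : dotp a (row i (z - z')) - dotp a a
    + (1 - alpha * L / 4) * dotp (a - b i) (a - b i)
    <= dotp (a - b i) (row i (z - z')).
  apply: (@cocoercive_row _ _ (q i)).
    have := subgrad_monotone (xn_subgrad z i) (xn_subgrad z' i).
    rewrite -scalerBr dotpZl pmulr_rge0 ?invr_gt0// => /le_trans; apply.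
    rewrite le_eqVlt; apply/orP; left; apply/eqP; congr dotp.
    by apply/rowP => j; rewrite !mxE; ring.
  exact: cocoercive.
have mean : n%:R * dotp a a <= \sum_i dotp a (row i (z - z')).
  have := subgrad_monotone (xh_subgrad z) (xh_subgrad z').
  rewrite -scalerBr dotpZl pmulr_rge0 ?invr_gt0// -/a.
  have -> : tuple_mean z - xh z - (tuple_mean z' - xh z') =
      n%:R^-1 *: (\sum_i row i (z - z')) - a.
    under eq_bigr do rewrite rowB.
    rewrite sumrB scalerBr /a /tuple_mean.
    by apply/rowP => j; rewrite !mxE; ring.
  rewrite dotpDl dotpNl dotpZl dotp_suml subr_ge0 ler_pdivlMl ?ltr0n//.
  by under [in X in _ -> X]eq_bigr do rewrite dotpC.
have := ler_sum (index_enum 'I_n) (fun i (_ : true) => main i).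
rewrite big_split sumrB /= sumr_const card_ord -mulr_sumr.
have -> : norm2 (p z - p z') ^+ 2
    = alpha^-1 ^+ 2 * \sum_i dotp (a - b i) (a - b i).
  rewrite norm2_sqr_rows mulr_sumr; apply: eq_bigr => i _.
  by rewrite rowE dotpZl dotpZr mulrA.
have -> : \sum_i dotp (row i (p z - p z')) (row i (z - z'))
    = alpha^-1 * \sum_i dotp (a - b i) (row i (z - z')).
  by rewrite mulr_sumr; apply: eq_bigr => i _; rewrite rowE dotpZl.
rewrite -[_ *+ n]mulr_natl => h; rewrite ler_pdivlMl//.
set S := \sum_i dotp (a - b i) (a - b i) in h *.
have -> : alpha * (alpha * (1 - alpha * L / 4) * (alpha^-1 ^+ 2 * S)) =
    (1 - alpha * L / 4) * S by field; rewrite gt_eqF.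
by apply: le_trans h; rewrite lerDr subr_ge0.
Qed.

Hypothesis alphaL : alpha * L < 2.

(** Cocoercivity with constant c gives the Lipschitz constant 1 / c; completing a
square in each block plays the part of the Cauchy-Schwarz inequality. *)
Lemma p_map_lipschitz z z' :
  norm2 (p z - p z') <= (alpha * (1 - alpha * L / 4))^-1 * norm2 (z - z').
Proof.
set c := alpha * (1 - alpha * L / 4).
have c0 : 0 < c by apply: mulr_gt0 => //; have := alphaL; lra.
rewrite -ler_sqr ?nnegrE ?mulr_ge0 ?invr_ge0 ?norm2_ge0 ?(ltW c0)//.
rewrite exprMn exprVn ler_pdivlMl ?exprn_gt0//.
have := p_map_cocoercive z z'; rewrite -/c.
rewrite !norm2_sqr_rows => coco.
have : \sum_i (2 * c * dotp (row i (p z - p z')) (row i (z - z'))) <=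
    \sum_i (c ^+ 2 * dotp (row i (p z - p z')) (row i (p z - p z'))
      + dotp (row i (z - z')) (row i (z - z'))).
  apply: ler_sum => i _.
  have := dotp_ge0 (c *: row i (p z - p z') - row i (z - z')).
  by move: (row i _) (row i _) => u w; rewrite !dotpE (dotpC w u); lra.
rewrite -mulr_sumr big_split /= -mulr_sumr => young.
have := ler_wpM2l (ltW c0) coco; lra.
Qed.

(** Proximal maps and the mean of the blocks are nonexpansive. *)
Lemma xhalf_lipschitz z z' : norm2 (xh z - xh z') <= norm2 (z - z').
Proof.
have := subgrad_monotone (xh_subgrad z) (xh_subgrad z').
rewrite -scalerBr dotpZl pmulr_rge0 ?invr_gt0//.
have -> : tuple_mean z - xh z - (tuple_mean z' - xh z') =
    tuple_mean (z - z') - (xh z - xh z').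
  rewrite /tuple_mean; under [in RHS]eq_bigr do rewrite rowB.
  by rewrite sumrB scalerBr; apply/rowP => j; rewrite !mxE; ring.
move: (xh z - xh z') => u; rewrite dotpDl dotpNl subr_ge0 => le1.
apply: le_trans (norm2_tuple_mean_le _); rewrite -ler_sqr ?nnegrE ?norm2_ge0//.
move: (tuple_mean _) le1 => m le1; rewrite !norm2_sqr.
have := dotp_ge0 (m - u); rewrite !dotpE (dotpC u m); lra.
Qed.

(** Averaged over the block i that is updated, the cross term of
|z - alpha p_i(z) - zs| ^ 2 becomes the inner product of p z and z - zs divided
by n, to which cocoercivity applies: the squared distance to any zero of p is a
supermartingale, with a decrease proportional to |p z| ^ 2. *)
Lemma sppg_step_descent z zs : p zs = 0 ->
  n%:R^-1 * \sum_i norm2 (step i z - zs) ^+ 2 <=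
  norm2 (z - zs) ^+ 2 - alpha ^+ 2 * (1 - alpha * L / 2) / n%:R * norm2 (p z) ^+ 2.
Proof.
move=> pzs.
pose D i := dotp (row i (p z)) (row i (z - zs)).
pose N i := dotp (row i (p z)) (row i (p z)).
have stepE i : norm2 (step i z - zs) ^+ 2 =
    norm2 (z - zs) ^+ 2 + (alpha ^+ 2 * N i - 2 * alpha * D i).
  rewrite !norm2_sqr_rows (bigD1 i)//= [in RHS](bigD1 i)//=.
  rewrite (eq_bigr (fun j => dotp (row j (z - zs)) (row j (z - zs)))); last first.
    move=> j ji; suff -> : row j (step i z - zs) = row j (z - zs) by [].
    by rewrite !rowB row_step (negbTE ji).
  have -> : row i (step i z - zs) =
      row i (z - zs) - alpha *: row i (p z).
    rewrite !rowB row_step eqxx.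
    by apply/rowP => j; rewrite !mxE; ring.
  rewrite /D /N; move: (row i (z - zs)) (row i (p z)) => u w.
  by rewrite !dotpE (dotpC w u); ring.
rewrite (eq_bigr _ (fun i _ => stepE i)) big_split /= sumr_const card_ord.
rewrite sumrB -!mulr_sumr.
have n0 : 0 < n%:R :> R by rewrite ltr0n.
rewrite ler_pdivrMl//.
have := p_map_cocoercive z zs; rewrite pzs subr0 -/(\sum_i D i) => coco.
have -> : \sum_i N i = norm2 (p z) ^+ 2 by rewrite norm2_sqr_rows.
move: (norm2 (p z) ^+ 2) (\sum_i D i) coco => Np SD coco.
apply: (@le_trans _ _ (n%:R * norm2 (z - zs) ^+ 2
    - alpha ^+ 2 * (1 - alpha * L / 2) * Np)).
  rewrite [n%:R * _]mulr_natl lerD2l; have := ler_wpM2l (ltW alpha_gt0) coco; lra.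
by rewrite le_eqVlt; apply/orP; left; apply/eqP; field; rewrite gt_eqF.
Qed.

End FixedPointOperator.

(** * Zeros of the residual map, minimizers and saddle points *)

Section Optimality.
Context {R : realType} {d n : nat}.
Hypothesis hn : (0 < n)%N.
Variables (r : 'rV[R]_d -> \bar R) (f g : 'I_n -> 'rV[R]_d -> \bar R).
Variable L : R.
Hypothesis hfconv : forall i, econvex (f i).
Hypothesis hfdiff : forall i, edifferentiable (f i).
Hypothesis hflip : forall i, lipschitz_grad L (f i).

Let F i (x : 'rV[R]_d) : R := fine (f i x).

Lemma argmin_objective_subgrad x (u : 'rV[R]_d) (v : 'I_n -> 'rV[R]_d) :
  subgrad r x u -> (forall i, subgrad (g i) x (v i)) ->
  u + n%:R^-1 *: \sum_i (v i + grad (f i) x) = 0 ->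
  argmin (objective r f g) x.
Proof.
move=> [rfin ru] hg eq0 y.
have [rx rxE] : exists c, r x = c%:E by exists (fine (r x)); rewrite fineK.
pose G i := fine (g i x).
have GE i : g i x = (G i)%:E by have [gfin _] := hg i; rewrite fineK.
have fE i w : f i w = (F i w)%:E := edifferentiable_fin (hfdiff i) w.
have n0 : 0 <= n%:R^-1 :> R by rewrite invr_ge0.
have -> : objective r f g x =
    (rx + dotp u (y - x) + n%:R^-1 * \sum_i (F i x + dotp (grad (f i) x) (y - x)
      + (G i + dotp (v i) (y - x))))%:E.
  rewrite /objective rxE (eq_bigr (fun i => (F i x + G i)%:E)); last first.
    by move=> i _; rewrite fE GE.
  rewrite sumEFin -EFinM -EFinD; congr EFin; rewrite -addrA; congr (_ + _).
  have -> : \sum_i (F i x + dotp (grad (f i) x) (y - x) + (G i + dotp (v i) (y - x)))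
      = \sum_i (F i x + G i) + dotp (\sum_i (v i + grad (f i) x)) (y - x).
    rewrite dotp_suml -big_split; apply: eq_bigr => i _ /=.
    by rewrite (dotpDl (v i)); ring.
  rewrite mulrDr -dotpZl addrCA -dotpDl eq0 dotp0l; ring.
rewrite /objective EFinD leeD//; first by have := ru y; rewrite rxE.
rewrite EFinM lee_wpmul2l// -sumEFin lee_sum// => i _.
rewrite EFinD leeD//; last by have [_ /(_ y)] := hg i; rewrite GE.
rewrite fE lee_fin -[leRHS]/(F i y).
have := grad_le (hfconv i) (hfdiff i) (@hflip i) x (y - x).
by rewrite -/(F i x) -/(F i (x + _)) (addrC x) subrK.
Qed.

(** Minimality of f + g + <w, .> at x is tested on the segment to y: g is bounded by
convexity and f by its expansion at x, whose error is of second order. *)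
Lemma subgrad_of_sum_min i x w :
  ccp (g i) -> g i x \is a fin_num ->
  (forall y, (f i x + g i x <= f i y + g i y + (dotp w (y - x))%:E)%E) ->
  subgrad (g i) x (- w - grad (f i) x).
Proof.
move=> [gconv _ [gN _]] gfin hmin; split => // y.
have fE z : f i z = (F i z)%:E := edifferentiable_fin (hfdiff i) z.
have [G GE] : exists c, g i x = c%:E by exists (fine (g i x)); rewrite fineK.
case E : (g i y) (gN y) => [b| |]// _; last exact: leey.
rewrite GE -EFinD lee_fin -lerBrDl.
apply: (@le_of_quadratic_error _ _ _ (L / 2 * norm2 (y - x) ^+ 2)).
move=> t /andP[t0 t1].
have := descent (hfdiff i) (@hflip i) x (t *: (y - x)).
rewrite -[fine (f i x)]/(F i x) -[fine _]/(F i _) norm2_sqr => hdesc.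
have := gconv y x t; rewrite (ltW t0) t1 => /(_ isT).
have <- : x + t *: (y - x) = t *: y + (1 - t) *: x.
  by apply/rowP => j; rewrite !mxE; ring.
have := hmin (x + t *: (y - x)).
rewrite E !fE GE; case: (g i _) (gN (x + t *: (y - x))) => [c| |]// _.
rewrite -!EFinM -!EFinD !lee_fin => h1 h2.
move: hdesc h1; rewrite norm2_sqr (addrC x) addrK.
move: (y - x) => u; rewrite !dotpE; lra.
Qed.

Lemma lagrangian_fin y (ys nu : 'M[R]_(n, d)) (a : R) (G : 'I_n -> R) :
  r y = a%:E -> (forall i, g i (row i ys) = (G i)%:E) ->
  lagrangian r f g y ys nu = (a + n%:R^-1 * (\sum_i (F i (row i ys) + G i)
     + \sum_i dotp (row i nu) (row i ys - y)))%:E.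
Proof.
move=> ry gy; rewrite /lagrangian ry (eq_bigr (fun i => (F i (row i ys) + G i)%:E)).
  by rewrite sumEFin -EFinM -!EFinD mulrDr addrA.
by move=> i _; rewrite gy (edifferentiable_fin (hfdiff i)).
Qed.

Lemma lagrangian_lty_fin x (xs nu : 'M[R]_(n, d)) :
  ccp r -> (forall i, ccp (g i)) -> (lagrangian r f g x xs nu < +oo)%E ->
  r x \is a fin_num /\ (forall i, g i (row i xs) \is a fin_num).
Proof.
move=> [_ _ [rN _]] hg; rewrite /lagrangian.
have gN i z : g i z != -oo%E by have [_ _ [+ _]] := hg i; apply.
have fE i z : f i z = (F i z)%:E := edifferentiable_fin (hfdiff i) z.
have fgN i : (f i (row i xs) + g i (row i xs))%E != -oo%E.
  by rewrite fE; move: (gN i (row i xs)); case: (g i _).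
set S := (\sum_(i < n) _)%E.
have n0 : 0 < n%:R^-1 :> R by rewrite invr_gt0 ltr0n.
have SN : S != -oo%E.
  rewrite /S esum_eqNy negb_exists; apply/forallP => i /=; exact: fgN.
have [Sy|Sy] := eqVneq S +oo%E.
  rewrite Sy gt0_muley ?lte_fin//.
  by move: (rN x); case: (r x).
have Sfin : S \is a fin_num by move: SN Sy; case: (S).
rewrite -(fineK Sfin) -EFinM; split.
  by move: H (rN x); case: (r x).
move=> i; move: Sfin; rewrite /S sum_fin_num => /allP /= h.
have : (f i (row i xs) + g i (row i xs))%E \is a fin_num.
  by apply: h; apply/mapP; exists i => //; rewrite mem_filter mem_index_enum.
by rewrite fin_numD => /andP[].
Qed.

(** Maximality in nu forces all blocks of xs to equal x, as nu may be moved along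
xs - x. Minimality in one variable at a time, the others being kept at x, gives
the optimality conditions of r and of each f i + g i. *)
Lemma saddle_point_subgrad x (xs nu : 'M[R]_(n, d)) :
  ccp r -> (forall i, ccp (g i)) -> saddle_point r f g x xs nu ->
  subgrad r x (tuple_mean nu) /\
  forall i, subgrad (g i) x (- row i nu - grad (f i) x).
Proof.
move=> hr hg [hmin hmax].
have n0 : 0 < n%:R :> R by rewrite ltr0n.
have ni0 : 0 < n%:R^-1 :> R by rewrite invr_gt0.
have rN z : r z != -oo%E by have [_ _ [+ _]] := hr; apply.
have gN i z : g i z != -oo%E by have [_ _ [+ _]] := hg i; apply.
have [rfin gfin] : r x \is a fin_num /\
    (forall i, g i (row i xs) \is a fin_num).
  apply: (lagrangian_lty_fin hr hg (nu := nu)).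
  have [_ _ [_ [x1 hx1]]] := hr.
  have /choice [ys hys] : forall i, exists z, g i z != +oo%E.
    by move=> i; have [_ _ [_]] := hg i.
  pose Y : 'M[R]_(n, d) := \matrix_i ys i.
  apply: le_lt_trans (hmin x1 Y) _.
  rewrite (@lagrangian_fin x1 Y nu (fine (r x1)) (fun i => fine (g i (ys i)))).
  - exact: ltry.
  - by rewrite fineK//; move: hx1 (rN x1); case: (r x1).
  - by move=> i; rewrite rowK fineK//; move: (hys i) (gN i (ys i)); case: (g i _).
have rE := esym (fineK rfin); have gE i := esym (fineK (gfin i)).
(* The multiplier nu + (xs - x) adds the squared norms of xs_i - x. *)
have xsE i : row i xs = x.
  apply/eqP; rewrite -subr_eq0; apply/eqP/dotp_eq0.
  have := hmax (nu + \matrix_i (row i xs - x)).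
  rewrite !(lagrangian_fin _ rE gE) lee_fin lerD2l ler_pM2l// lerD2l.
  under eq_bigr do rewrite linearD /= rowK dotpDl.
  rewrite big_split /= gerDl => le0.
  apply/eqP; rewrite eq_le dotp_ge0 andbT.
  apply: le_trans le0; rewrite (bigD1 i)//= lerDl sumr_ge0// => j _.
  exact: dotp_ge0.
have gE' i : g i x = (fine (g i (row i xs)))%:E by rewrite -{1}(xsE i).
split.
  split=> // y; case E : (r y) (rN y) => [b| |]// _; last exact: leey.
  have := hmin y xs; rewrite (lagrangian_fin _ rE gE) (lagrangian_fin _ E gE).
  rewrite rE -EFinD !lee_fin (_ : \sum_i dotp (row i nu) (row i xs - x) = 0).
    rewrite (_ : \sum_i dotp _ (row i xs - y) = - n%:R * dotp (tuple_mean nu) (y - x)).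
      rewrite !mulrDr mulNr mulrN mulrA mulVf ?gt_eqF// mul1r; lra.
    rewrite /tuple_mean dotpZl mulrA mulNr mulfV ?gt_eqF// mulN1r.
    rewrite dotp_suml -sumrN; apply: eq_bigr => i _.
    by rewrite xsE -dotpNr opprB.
  by apply: big1 => i _; rewrite xsE subrr dotpC dotp0l.
move=> i; apply: subgrad_of_sum_min => //; first by rewrite gE'.
move=> y; case E : (g i y) (gN i y) => [b| |]// _; last first.
  by rewrite (edifferentiable_fin (hfdiff i) y)/= leey.
pose ys : 'M[R]_(n, d) := \matrix_j (if j == i then y else x).
pose G j := if j == i then b else fine (g j (row j xs)).
have GE j : g j (row j ys) = (G j)%:E.
  by rewrite rowK /G; case: eqP => [->|_].
have := hmin x ys; rewrite (lagrangian_fin _ rE gE) (lagrangian_fin _ rE GE).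
rewrite lee_fin lerD2l ler_pM2l//.
pose T := \sum_(j | j != i) (F j x + fine (g j x)).
have -> : \sum_j (F j (row j xs) + fine (g j (row j xs))) =
    F i x + fine (g i x) + T.
  by under eq_bigr do rewrite xsE; rewrite (bigD1 i).
have -> : \sum_j (F j (row j ys) + G j) = F i y + b + T.
  rewrite (bigD1 i)//= rowK /G eqxx; congr (_ + _); apply: eq_bigr => j ji.
  by rewrite rowK (negbTE ji) xsE.
have -> : \sum_j dotp (row j nu) (row j xs - x) = 0.
  by apply: big1 => j _; rewrite xsE subrr dotpC dotp0l.
have -> : \sum_j dotp (row j nu) (row j ys - x) = dotp (row i nu) (y - x).
  rewrite (bigD1 i)//= rowK eqxx big1 ?addr0// => j ji.
  by rewrite rowK (negbTE ji) subrr dotpC dotp0l.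
rewrite gE' xsE (edifferentiable_fin (hfdiff i) x) (edifferentiable_fin (hfdiff i) y).
rewrite -!EFinD !lee_fin -[fine (f i x)]/(F i x) -[fine (f i y)]/(F i y); lra.
Qed.

End Optimality.

(** The fixed point has blocks z_i = x + alpha nu_i: both proximal steps then
return x by the optimality conditions of the saddle point. *)
Lemma saddle_point_fixed_point (R : realType) d n (hn : (0 < n)%N)
    (r : 'rV[R]_d -> \bar R) (f g : 'I_n -> 'rV[R]_d -> \bar R) (L alpha : R) :
  0 < alpha -> ccp r -> (forall i, ccp (g i)) ->
  (forall i, edifferentiable (f i)) -> (forall i, lipschitz_grad L (f i)) ->
  (exists x xs nu, saddle_point r f g x xs nu) ->
  exists z, p_map alpha r f g z = 0.
Proof.
move=> a0 hr hg hfdiff hflip [x [xs [nu hs]]].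
have [rs gs] := saddle_point_subgrad hn hfdiff hflip hr hg hs.
pose z : 'M[R]_(n, d) := \matrix_i (x + alpha *: row i nu).
have n0 : n%:R != 0 :> R by rewrite pnatr_eq0 -lt0n.
have meanE : tuple_mean z = x + alpha *: tuple_mean nu.
  rewrite /tuple_mean; under eq_bigr do rewrite rowK.
  rewrite big_split /= sumr_const card_ord -scaler_sumr scalerDr.
  by rewrite -[x *+ n]scaler_nat scalerA mulVf// scale1r !scalerA mulrC.
have xE : xhalf alpha r z = x.
  apply: subgrad_prox => //; rewrite meanE (addrC x) addrK scalerA.
  by rewrite mulVf ?gt_eqF// scale1r.
exists z; apply/row_matrixP => i; rewrite row0 rowK xE.
rewrite (_ : xnext alpha r f g z i = x) ?subrr ?scaler0//.
rewrite /xnext xE; apply: subgrad_prox => //; rewrite rowK.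
have -> : 2 *: x - (x + alpha *: row i nu) - alpha *: grad (f i) x - x =
    alpha *: (- row i nu - grad (f i) x).
  by apply/rowP => j; rewrite !mxE; ring.
by rewrite scalerA mulVf ?gt_eqF// scale1r.
Qed.

(** At a zero of p all proximal steps return x, and the optimality conditions are
those of the terms of the objective. The subgradient of r is tuple_mean z - x and
that of f i + g i is x - z_i, up to the factor 1 / alpha: they cancel on average. *)
Lemma fixed_point_argmin (R : realType) d n (hn : (0 < n)%N)
    (r : 'rV[R]_d -> \bar R) (f g : 'I_n -> 'rV[R]_d -> \bar R) (L alpha : R)
    (z : 'M[R]_(n, d)) (x : 'rV[R]_d) :
  0 < alpha -> (forall i, econvex (f i)) ->
  (forall i, edifferentiable (f i)) -> (forall i, lipschitz_grad L (f i)) ->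
  subgrad r x (alpha^-1 *: (tuple_mean z - x)) ->
  (forall i, subgrad (g i) x
    (alpha^-1 *: (2 *: x - row i z - alpha *: grad (f i) x - x))) ->
  argmin (objective r f g) x.
Proof.
move=> a0 hfconv hfdiff hflip rx gx.
apply: (argmin_objective_subgrad hfconv hfdiff hflip rx gx).
have n0 : n%:R != 0 :> R by rewrite pnatr_eq0 -lt0n.
rewrite (eq_bigr (fun i => alpha^-1 *: (x - row i z))); last first.
  move=> i _; move: (grad (f i) x) => q; apply/rowP => j; rewrite !mxE.
  by field; rewrite gt_eqF.
have -> : \sum_(i < n) alpha^-1 *: (x - row i z) =
    n%:R *: (alpha^-1 *: (x - tuple_mean z)).
  rewrite -scaler_sumr sumrB sumr_const card_ord -[x *+ n]scaler_nat.
  rewrite scalerA mulrC -scalerA; congr (_ *: _).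
  by rewrite scalerBr scalerA mulfV// scale1r.
by rewrite scalerA mulVf// scale1r -scalerDr subrKA subrr scaler0.
Qed.

(** * Expectations over finite histories of draws *)

Section FiniteHistories.
Context {R : realType} {n : nat}.
Hypothesis hn : (0 < n)%N.
Implicit Types G H : seq 'I_n -> R.

(** The expectation of G over a history of k uniform draws, written as an iterated
average so that conditioning on the first k draws is definitional. *)
Fixpoint avg (k : nat) G : R :=
  if k is k'.+1 then avg k' (fun s => n%:R^-1 * \sum_i G (rcons s i))
  else G [::].

Lemma ler_avg k G H : (forall s, G s <= H s) -> avg k G <= avg k H.
Proof.
elim: k G H => [|k IH] G H GH /=; first exact: GH.
by apply: IH => s; rewrite ler_wpM2l ?invr_ge0// ler_sum.
Qed.

Lemma eq_avg k G H : (forall s, G s = H s) -> avg k G = avg k H.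
Proof. by move=> /funext ->. Qed.

Lemma avg_lin k c G H : avg k (fun s => c * G s + H s) = c * avg k G + avg k H.
Proof.
elim: k G H => [//|k IH] G H /=; rewrite -IH; apply: eq_avg => s.
rewrite big_split /= -mulr_sumr mulrDr; ring.
Qed.

Lemma avg0 k : avg k (fun=> 0) = 0.
Proof.
elim: k => [//|k IH] /=; rewrite -[RHS]IH; apply: eq_avg => s.
by rewrite big1 ?mulr0.
Qed.

Lemma avgZ k c G : avg k (fun s => c * G s) = c * avg k G.
Proof.
rewrite -[RHS]addr0 -(avg0 k) -avg_lin.
by apply: eq_avg => s; rewrite addr0.
Qed.

Lemma avg_sum k (J : Type) (s : seq J) (G : J -> seq 'I_n -> R) :
  avg k (fun h => \sum_(j <- s) G j h) = \sum_(j <- s) avg k (G j).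
Proof.
elim: s => [|j s IH].
  by rewrite big_nil -[RHS](avg0 k); apply: eq_avg => h; rewrite big_nil.
rewrite big_cons -IH -[avg k (G j)]mul1r -avg_lin.
by apply: eq_avg => h; rewrite big_cons mul1r.
Qed.

Lemma avg_supermartingale k (V : seq 'I_n -> R) :
  (forall s, n%:R^-1 * \sum_i V (rcons s i) <= V s) -> avg k V <= V [::].
Proof.
by move=> sm; elim: k => [//|k IH] /=; apply: le_trans IH; exact: ler_avg.
Qed.

End FiniteHistories.

Definition history (T : Type) n (I : nat -> T -> 'I_n) (k : nat) (w : T) :=
  [seq I j w | j <- iota 0 k].

Lemma historyS (T : Type) n (I : nat -> T -> 'I_n) k w :
  history I k.+1 w = rcons (history I k w) (I k w).
Proof. by rewrite /history -addn1 iotaD map_cat cats1 add0n. Qed.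

Section Draws.
Context {R : realType} {n : nat} {disp : measure_display}.
Context {T : measurableType disp} (P : probability T R).
Hypothesis hn : (0 < n)%N.
Variable I : nat -> T -> 'I_n.
Hypothesis hunif : forall k, uniform_draw P (I k).
Hypothesis hindep : independent_draws P I.

Lemma measurable_history k (Y : set (seq 'I_n)) :
  measurable (history I k @^-1` Y).
Proof.
elim: k Y => [|k IH] Y.
  have [Y0|Y0] := pselect (Y [::]).
    by rewrite (_ : _ @^-1` _ = setT)//; apply/seteqP; split.
  by rewrite (_ : _ @^-1` _ = set0)//; apply/seteqP; split.
rewrite (_ : _ @^-1` _ = \bigcup_(i in [set: 'I_n])
   (history I k @^-1` [set s | Y (rcons s i)] `&` I k @^-1` [set i])).
  apply: fin_bigcup_measurable; first exact: finite_finset.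
  by move=> i _; apply: measurableI; [exact: IH|have [] := hunif k i].
apply/seteqP; split => w.
  by rewrite /= historyS => Yw; exists (I k w).
by move=> [i _ [/= Yw Ikw]]; rewrite historyS Ikw.
Qed.

Lemma measurable_fun_history disp' (U : measurableType disp') k
    (G : seq 'I_n -> U) : measurable_fun setT (fun w => G (history I k w)).
Proof. by move=> _ Y mY; rewrite setTI; exact: (measurable_history k (G @^-1` Y)). Qed.

Lemma future_law k (s : seq 'I_n) :
  P [set w | [seq I j w | j <- iota k (size s)] = s] = (n%:R^-1 ^+ size s)%:E.
Proof.
pose i0 := Ordinal hn.
pose A j := [set nth i0 s (j - k)].
rewrite (_ : mkset _ = \bigcap_(j in [set` iota k (size s)]) (I j @^-1` A j)).
  rewrite hindep ?iota_uniq// (eq_bigr (fun=> n%:R^-1%:E)); last first.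
    by move=> j _; have [] := hunif j (nth i0 s (j - k)).
  rewrite -[in RHS](size_iota k (size s)).
  elim: (iota _ _) => [|j t IH]; first by rewrite big_nil.
  by rewrite big_cons IH -EFinM exprS.
apply/seteqP; split => w /=.
  move=> ws j /=; rewrite mem_iota => /andP[kj jk].
  rewrite /A /= -[in RHS]ws (nth_map 0%N) ?size_iota ?ltn_subLR//.
  by rewrite nth_iota ?ltn_subLR// subnKC.
move=> ws; apply: (@eq_from_nth _ i0); rewrite size_map size_iota// => j js.
rewrite (nth_map 0%N) ?size_iota// nth_iota//.
have := ws (k + j)%N; rewrite /= mem_iota leq_addr ltn_add2l => /(_ js).
by rewrite /A /= addKn.
Qed.

(** The induction on k moves the last draw of the history into the prescribed future
s, so that independence is used once, for the law of s, when the history is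
empty. *)
Lemma integral_history_future k (G : seq 'I_n -> R) (s : seq 'I_n) :
  (forall t, 0 <= G t) ->
  (\int[P]_w (G (history I k w)
     * ([seq I j w | j <- iota k (size s)] == s)%:R)%:E
   = (n%:R^-1 ^+ size s * avg k G)%:E)%E.
Proof.
elim: k G s => [|k IH] G s G0.
  rewrite /=; pose B := [set w | [seq I j w | j <- iota 0 (size s)] = s].
  have mB : measurable B := measurable_history (size s) [set s].
  transitivity (\int[P]_w ((G [::])%:E * (\1_B w)%:E))%E.
    apply: eq_integral => w _; rewrite -EFinM; congr (_ * _)%:E.
    rewrite indicE; suff -> : (w \in B) =
        ([seq I j w | j <- iota 0 (size s)] == s) by [].
    by apply/idP/idP => [|/eqP ws]; rewrite inE => // /eqP.
  rewrite ge0_integralZl ?lee_fin//; last first.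
    by apply/measurable_EFinP; exact: measurable_indic.
  rewrite integral_indic// setIT.
  transitivity ((G [::])%:E * (n%:R^-1 ^+ size s)%:E)%E.
    by congr (_ * _)%E; exact: future_law.
  by rewrite -EFinM mulrC.
transitivity (\int[P]_w \sum_(i < n) (G (rcons (history I k w) i)
     * ([seq I j w | j <- iota k (size (i :: s))] == i :: s)%:R)%:E)%E.
  apply: eq_integral => w _; rewrite sumEFin; congr EFin.
  rewrite historyS (bigD1 (I k w))//= eqseq_cons eqxx/= big1 ?addr0//.
  by move=> i ik; rewrite eqseq_cons eq_sym (negbTE ik) mulr0.
rewrite ge0_integral_sum//; first last.
- move=> i w _; rewrite lee_fin mulr_ge0//.
- move=> i; apply/measurable_EFinP.
  pose H h := G (rcons (take k h) i) * (drop k h == i :: s)%:R.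
  rewrite (_ : (fun w => _) = fun w => H (history I (k + (size s).+1) w)).
    exact: measurable_fun_history.
  apply/funext => w; rewrite /H /history iotaD map_cat.
  by rewrite take_size_cat ?drop_size_cat ?size_map ?size_iota.
rewrite (eq_bigr _ (fun i _ => IH (fun h => G (rcons h i)) (i :: s) _))//.
rewrite sumEFin; congr EFin; rewrite /= -mulr_sumr avgZ avg_sum.
by rewrite exprS mulrA (mulrC n%:R^-1).
Qed.

Lemma integral_history k (G : seq 'I_n -> R) : (forall t, 0 <= G t) ->
  (\int[P]_w (G (history I k w))%:E = (avg k G)%:E)%E.
Proof.
move=> G0; have := integral_history_future k [::] G0.
by rewrite expr0 mul1r => <-; apply: eq_integral => w _; rewrite eqxx mulr1.
Qed.

(** Fatou's lemma: the lower limit of G k has expectation at most C, so it is finite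
almost everywhere. *)
Lemma ae_liminf_history_bounded (G : nat -> seq 'I_n -> R) (C : R) :
  (forall k s, 0 <= G k s) -> (forall k, avg k (G k) <= C) ->
  {ae P, forall w, exists M : R, forall N, exists2 k, (N <= k)%N &
    G k (history I k w) <= M}.
Proof.
move=> G0 GC.
pose u k w := (G k (history I k w))%:E.
have mu k : measurable_fun setT (u k).
  by apply/measurable_EFinP; exact: measurable_fun_history.
have u0 k w : setT w -> (0 <= u k w)%E by rewrite lee_fin.
pose l w := limn_einf (u ^~ w).
have ml : measurable_fun setT l.
  rewrite (_ : l = fun w => (- limn_esup (fun k => - u k w))%E); last first.
    by apply/funext => w; rewrite -limn_einfN; congr limn_einf;
      apply/funext => k; rewrite /comp oppeK.
  apply: measurableT_comp => //; apply: measurable_fun_limn_esup => k.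
  exact: measurableT_comp.
have einfs0 w k : (0 <= einfs (u ^~ w) k)%E.
  by apply: le_ereal_inf_tmp => _ [j _ <-]; exact: u0.
have l0 w : (0 <= l w)%E.
  rewrite /l limn_einf_lim; apply: lime_ge; first exact: is_cvg_einfs.
  exact: nearW.
have lint : P.-integrable setT l.
  apply/integrableP; split => //.
  under eq_integral do rewrite gee0_abs//.
  apply: le_lt_trans (fatou P measurableT mu u0) _.
  apply: (@le_lt_trans _ _ C%:E); last exact: ltry.
  rewrite limn_einf_lim; apply: lime_le; first exact: is_cvg_einfs.
  apply: nearW => k; apply: le_trans (ereal_inf_lbound _) _.
    by exists k => //=.
  by rewrite integral_history// lee_fin.
apply: filterS (integrable_ae measurableT lint) => w /(_ Logic.I) lfin.
apply: contrapT => noM.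
suff : l w = +oo%E by move=> E; rewrite E in lfin.
have uy : u ^~ w @ \oo --> +oo%E.
  apply/cvgeyPgt => A.
  have /existsNP [N hN] : ~ forall N, exists2 k, (N <= k)%N & G k (history I k w) <= A.
    by move=> h; apply: noM; exists A.
  exists N => // k /= Nk; rewrite lte_fin ltNge; apply/negP => kA.
  by apply: hN; exists k.
rewrite /l is_cvg_limn_einfE; first exact: cvg_lim.
by apply/cvg_ex; exists +oo%E.
Qed.

End Draws.

(** * Upcrossings and stochastic descent *)

Section Upcrossings.
Context {R : realType}.
Variable a : R.
Hypothesis a_gt0 : 0 < a.

(** The state of the upcrossing counter between the levels a and 2 a: whether the
sequence has been at or below a since the last completed upcrossing, and the
number of upcrossings completed so far. *)
Definition crossing_next (hu : bool * nat) (v : R) : bool * nat :=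
  if hu.1 then if 2 * a <= v then (false, hu.2.+1) else (true, hu.2)
  else (v <= a, hu.2).

Fixpoint crossings (v : nat -> R) (k : nat) : bool * nat :=
  if k is k'.+1 then crossing_next (crossings v k') (v k'.+1)
  else (v 0%N <= a, 0%N).

Lemma crossings_nondecreasing v j k :
  (j <= k)%N -> ((crossings v j).2 <= (crossings v k).2)%N.
Proof.
elim: k => [|k IH]; first by rewrite leqn0 => /eqP ->.
rewrite leq_eqVlt => /predU1P[->//|]; rewrite ltnS => /IH /leq_trans; apply.
by rewrite /= /crossing_next; case: ifP => // _; case: ifP => //= _.
Qed.

Lemma crossings_low v k : v k <= a -> (crossings v k).1.
Proof.
case: k => [|k] //= vk; rewrite /crossing_next; case: ifP => _ //.
by case: leP => //= vk'; have := a_gt0; lra.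
Qed.

(** Once the counter has reached its maximum, a visit below a opens an upcrossing
that is never completed. *)
Lemma crossings_bounded v (C : nat) : (forall k, ((crossings v k).2 <= C)%N) ->
  (forall N, exists2 k, (N <= k)%N & v k <= a) ->
  exists N, forall k, (N <= k)%N -> v k < 2 * a.
Proof.
move=> uC low.
have [m mmax] : exists m, forall k, ((crossings v k).2 <= (crossings v m).2)%N.
  pose S := fun c : nat => `[< exists k, (crossings v k).2 = c >].
  have S0 : exists c, S c by exists (crossings v 0).2; apply/asboolP; exists 0%N.
  have SC c : S c -> (c <= C)%N by move=> /asboolP[k <-].
  case: (ex_maxnP S0 SC) => _ /asboolP[m <-] mmax.
  by exists m => k; apply: mmax; apply/asboolP; exists k.
have [N mN vN] := low m.
have const k : (N <= k)%N -> (crossings v k).2 = (crossings v m).2.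
  move=> Nk; apply/eqP; rewrite eqn_leq mmax crossings_nondecreasing//.
  exact: leq_trans Nk.
suff inv k : (N <= k)%N -> (crossings v k).1 /\ v k < 2 * a.
  by exists N => k /inv[].
elim: k => [|k IH].
  rewrite leqn0 => /eqP N0; rewrite N0 in vN; split; first exact: crossings_low.
  by have := a_gt0; lra.
rewrite leq_eqVlt => /predU1P[E|].
  rewrite -E; split; first exact: crossings_low.
  by have := a_gt0; lra.
rewrite ltnS => Nk; have [hk _] := IH Nk.
have := const k.+1 (leqW Nk); rewrite -(const k Nk) /= /crossing_next hk.
by case: leP => [_ /= /eqP|//]; rewrite gtn_eqF.
Qed.

End Upcrossings.

Section StochasticDescent.
Context {R : realType} {n : nat}.
Hypothesis hn : (0 < n)%N.

Definition trajectory (X : Type) (next : 'I_n -> X -> X) (x0 : X)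
  (s : seq 'I_n) : X := foldl (fun x i => next i x) x0 s.

Lemma trajectory_rcons (X : Type) (next : 'I_n -> X -> X) x0 s i :
  trajectory next x0 (rcons s i) = next i (trajectory next x0 s).
Proof. exact: foldl_rcons. Qed.

Lemma avg_potential (X : Type) (next : 'I_n -> X -> X) (Psi : X -> R) x0 k :
  (forall x, n%:R^-1 * \sum_i Psi (next i x) <= Psi x) ->
  avg k (fun s => Psi (trajectory next x0 s)) <= Psi x0.
Proof.
move=> sm; apply: (@avg_supermartingale _ _ k (fun s => Psi (trajectory next x0 s))).
by move=> s; under eq_bigr do rewrite trajectory_rcons.
Qed.

Lemma avg_cst_ord (c : R) : n%:R^-1 * \sum_(i < n) c = c.
Proof.
by rewrite sumr_const card_ord -[c *+ n]mulr_natl mulKf// pnatr_eq0 -lt0n.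
Qed.

Context {disp : measure_display} {T : measurableType disp} (P : probability T R).
Variable I : nat -> T -> 'I_n.
Hypothesis hunif : forall k, uniform_draw P (I k).
Hypothesis hindep : independent_draws P I.

Variables (Z : Type) (step : 'I_n -> Z -> Z) (z0 : Z).
Variables (V N : Z -> R) (kappa : R).
Hypotheses (V_ge0 : forall z, 0 <= V z) (N_ge0 : forall z, 0 <= N z).
Hypothesis kappa_gt0 : 0 < kappa.
Hypothesis descent_step : forall z,
  n%:R^-1 * \sum_i V (step i z) <= V z - kappa * N z.

Let z (k : nat) (w : T) : Z := trajectory step z0 (history I k w).

Lemma zS k w : z k.+1 w = step (I k w) (z k w).
Proof. by rewrite /z historyS trajectory_rcons. Qed.

Let supermartingale x : n%:R^-1 * \sum_i V (step i x) <= V x.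
Proof. by apply: le_trans (descent_step _) _; rewrite gerBl mulr_ge0// ltW. Qed.

(** Telescoping of the expected decrease. *)
Lemma sum_avg_descent k :
  \sum_(j < k) avg j (fun s => N (trajectory step z0 s)) <= V z0 / kappa.
Proof.
rewrite ler_pdivlMr// mulrC.
suff : avg k (fun s => V (trajectory step z0 s))
    + kappa * \sum_(j < k) avg j (fun s => N (trajectory step z0 s)) <= V z0.
  apply: le_trans; rewrite lerDr.
  have <- : avg k (fun _ : seq 'I_n => 0 : R) = 0 by exact: avg0.
  exact: ler_avg.
elim: k => [|k IH]; first by rewrite big_ord0 mulr0 addr0.
apply: le_trans IH; rewrite big_ord_recr mulrDr addrCA [leRHS]addrC lerD2l.
rewrite /= addrC -avg_lin; apply: ler_avg => s.
under eq_bigr do rewrite trajectory_rcons.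
by rewrite addrC -lerBrDr; exact: descent_step.
Qed.

(** Doob's upcrossing inequality for a nonnegative supermartingale. The potential
Psi equals a times the number of upcrossings, plus V - a while one is open; it
is itself a supermartingale, since closing an upcrossing at a level of at least
2 a pays for the increment of the counter, and it is never below a times the
number of upcrossings minus a. The expected number of upcrossings is thus at
most 1. *)
Lemma ae_crossing a : 0 < a -> {ae P, forall w,
  (forall M, exists2 k, (M <= k)%N & V (z k w) <= a) ->
  exists M, forall k, (M <= k)%N -> V (z k w) < 2 * a}.
Proof.
move=> a0.
pose next i (x : Z * (bool * nat)) :=
  (step i x.1, crossing_next a x.2 (V (step i x.1))).
pose x0 := (z0, (V z0 <= a, 0%N)).
pose Psi (x : Z * (bool * nat)) : R :=
  a * x.2.2%:R + (if x.2.1 then V x.1 - a else 0).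
have PsiS x : n%:R^-1 * \sum_i Psi (next i x) <= Psi x.
  case: x => x [[] u].
    apply: (@le_trans _ _ (n%:R^-1 * \sum_i (a * u%:R - a + V (step i x)))).
      rewrite ler_wpM2l ?invr_ge0// ler_sum// => i _.
      rewrite /Psi /next /crossing_next /=; case: (leP (2 * a) _) => /= h.
        by rewrite -natr1; lra.
      by lra.
    rewrite big_split /= mulrDr avg_cst_ord /Psi /= -addrA.
    by have := supermartingale x; lra.
  apply: (@le_trans _ _ (n%:R^-1 * \sum_(i < n) (a * u%:R))).
    rewrite ler_wpM2l ?invr_ge0// ler_sum// => i _.
    by rewrite /Psi /next /crossing_next /=; case: (leP (V _)) => /= h; lra.
  by rewrite avg_cst_ord /Psi /= addr0.
pose G (k : nat) s : R := (trajectory next x0 s).2.2%:R.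
have Gavg k : avg k (G k) <= 1.
  rewrite -(ler_pM2l a0) mulr1 -subr_le0.
  have H : avg k (fun s => Psi (trajectory next x0 s)) <= Psi x0.
    exact: avg_potential.
  have Psi0 : Psi x0 <= 0 by rewrite /Psi /= mulr0 add0r; case: (leP (V _)) => h; lra.
  apply: le_trans Psi0; apply: le_trans H.
  have <- : avg k (fun _ : seq 'I_n => - a) = - a.
    by elim: k => [//|k IH] /=; rewrite -[RHS]IH; apply: eq_avg => s;
      rewrite avg_cst_ord.
  rewrite -avg_lin; apply: ler_avg => s; rewrite /G /Psi lerD2l.
  by case: ifP => // _; [rewrite lerDr|rewrite oppr_le0 ltW].
have G0 k s : 0 <= G k s by rewrite ler0n.
apply: filterS (ae_liminf_history_bounded hn hunif hindep G0 Gavg).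
move=> w [M hM].
have xE k : trajectory next x0 (history I k w) =
    (z k w, crossings a (fun k => V (z k w)) k).
  elim: k => [|k IH] //.
  by rewrite historyS trajectory_rcons IH /next /= zS.
(* The counter is nondecreasing, so a bound along a subsequence suffices. *)
apply: (@crossings_bounded _ _ a0 _ (Num.truncn M).+1) => k.
have [j kj] := hM k; rewrite /G xE /= => jM.
apply: leq_trans (crossings_nondecreasing _ _ kj) _.
rewrite -(ler_nat R); apply: le_trans jM _.
by apply/ltW/truncnS_gt.
Qed.

Lemma ae_frequently_bounded : {ae P, forall w, exists B, forall M,
  exists2 k, (M <= k)%N & V (z k w) <= B}.
Proof.
apply: (@ae_liminf_history_bounded _ _ _ _ _ hn _ hunif hindep
  (fun k s => V (trajectory step z0 s)) (V z0)) => // k.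
exact: avg_potential.
Qed.

(** V plus kappa times the accumulated residual is a supermartingale, so the series
of residuals has finite expectation. *)
Lemma ae_residual_cvg0 : {ae P, forall w, N (z k w) @[k --> \oo] --> (0 : R)}.
Proof.
pose next i (x : Z * R) := (step i x.1, x.2 + N x.1).
pose x0 := (z0, 0 : R).
pose Psi (x : Z * R) : R := V x.1 + kappa * x.2.
have PsiS x : n%:R^-1 * \sum_i Psi (next i x) <= Psi x.
  rewrite /Psi /= big_split /= mulrDr avg_cst_ord.
  by have := descent_step x.1; lra.
pose G (k : nat) s : R := `|(trajectory next x0 s).2|.
have nn s : 0 <= (trajectory next x0 s).2.
  elim/last_ind: s => [//|s i IH]; rewrite trajectory_rcons /=.
  by rewrite addr_ge0.
have Gavg k : avg k (G k) <= V z0 / kappa.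
  rewrite ler_pdivlMr// mulrC -avgZ.
  apply: (@le_trans _ _ (avg k (fun s => Psi (trajectory next x0 s)))).
    by apply: ler_avg => s; rewrite /G ger0_norm// /Psi lerDr.
  apply: le_trans (avg_potential _ _ PsiS) _.
  by rewrite /Psi /= mulr0 addr0.
apply: filterS (ae_liminf_history_bounded hn hunif hindep
  (fun k s => normr_ge0 _) Gavg).
move=> w [B hB].
have xE k : trajectory next x0 (history I k w) =
    (z k w, series (fun k => N (z k w)) k).
  elim: k => [|k IH]; first by rewrite /series /= big_geq.
  by rewrite historyS trajectory_rcons IH /next /= zS seriesSr.
have nd : nondecreasing_seq (series (fun k => N (z k w))).
  by apply: nondecreasing_series => k _ _; exact: N_ge0.
apply: cvg_series_cvg_0; apply: nondecreasing_is_cvgn => //.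
exists B => _ [j _ <-]; have [k jk] := hB j; rewrite /G xE /= => kB.
apply: le_trans (nd _ _ jk) _; apply: le_trans kB; exact: ler_norm.
Qed.

End StochasticDescent.

(** * Almost sure convergence of the iterates *)

(** The set of zeros is separable: for each rational matrix and each radius
1 / (k + 1) one zero is chosen within that distance, if there is one. *)
Lemma countable_dense_zeros (R : realType) m n (p : 'M[R]_(m, n) -> 'M[R]_(m, n)) z0 :
  p z0 = 0 -> exists q : nat -> 'M[R]_(m, n),
    (forall j, p (q j) = 0) /\
    forall z e, p z = 0 -> 0 < e -> exists j, norm2 (q j - z) < e.
Proof.
move=> pz0.
pose near_zero (c : 'M[rat]_(m, n) * nat) (z : 'M[R]_(m, n)) :=
  p z = 0 /\ norm2 (z - map_mx ratr c.1) < c.2.+1%:R^-1.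
pose q j := if unpickle j is Some c then
    if pselect (exists z, near_zero c z) is left h then projT1 (cid h) else z0
  else z0.
exists q; split.
  move=> j; rewrite /q; case: (unpickle j) => // c; case: pselect => // h.
  by case: (cid h) => z [].
move=> z e pz e0.
pose k := Num.truncn (2 / e).
have ke : k.+1%:R^-1 < e / 2.
  by rewrite invf_plt ?posrE ?divr_gt0// invf_div; exact: truncnS_gt.
pose d := (m * n).+1%:R^-1 / k.+2%:R : R.
have d0 : 0 < d by rewrite divr_gt0// invr_gt0.
have /choice [c hc] : forall ij : 'I_m * 'I_n, exists c : rat,
    `|z ij.1 ij.2 - ratr c| <= d.
  move=> [i j] /=.
  have lt : z i j - d < z i j + d by lra.
  have [c] := rat_in_itvoo lt; rewrite in_itv /= => /andP[c1 c2].
  by exists c; rewrite ler_norml; apply/andP; split; lra.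
pose c' : 'M[rat]_(m, n) := \matrix_(i, j) c (i, j).
have near : near_zero (c', k) z.
  split => //=; apply: (@le_lt_trans _ _ ((m * n).+1%:R * d)).
    apply: norm2_le_coord; last exact: ltW.
    by move=> i j; rewrite !mxE; exact: (hc (i, j)).
  by rewrite /d mulrA mulfV// mul1r ltf_pV2 ?posrE// ltr_nat.
exists (pickle (c', k)); rewrite /q pickleK; case: pselect => [h|[]]; last first.
  by exists z.
case: (cid h) => y [_ /= hy] /=; case: near => _ /= hz.
rewrite -[y](subrK (map_mx ratr c')) -addrA.
apply: le_lt_trans (norm2_triangle _ _) _.
by rewrite (norm2B _ z); apply: lt_trans (ltrD hy hz) _; rewrite [e]splitr ltrD.
Qed.

(** A cluster point l of u is a zero of p. With q j close to l, the sequence u visits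
a small ball around q j infinitely often, and since it makes finitely many
upcrossings it stays from some point on in a slightly larger one, hence close
to l. *)
Lemma cvg_of_no_crossing (R : realType) m n (p : 'M[R]_(m, n) -> 'M[R]_(m, n)) K
    (q : nat -> 'M[R]_(m, n)) (u : nat -> 'M[R]_(m, n)) :
  (forall x y, norm2 (p x - p y) <= K * norm2 (x - y)) ->
  norm2 (p (u k)) @[k --> \oo] --> (0 : R) ->
  (forall z e, p z = 0 -> 0 < e -> exists j, norm2 (q j - z) < e) ->
  (exists B, forall M, exists2 k, (M <= k)%N & norm2 (u k - q 0%N) ^+ 2 <= B) ->
  (forall j i : nat,
    (forall M, exists2 k, (M <= k)%N & norm2 (u k - q j) ^+ 2 <= i.+1%:R^-1) ->
    exists M, forall k, (M <= k)%N -> norm2 (u k - q j) ^+ 2 < 2 * i.+1%:R^-1) ->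
  exists l, p l = 0 /\ norm2 (u k - l) @[k --> \oo] --> (0 : R).
Proof.
move=> lip pu0 dense [B uB] nocross.
have [|l ul] := @frequently_bounded_cluster _ _ _ u (q 0%N) (B + 1).
  move=> M; have [k Mk kB] := uB M; exists k => //.
  by have := sqr_ge0 (norm2 (u k - q 0%N) - 1); have := norm2_ge0 (u k - q 0%N); lra.
have pl : p l = 0.
  apply: norm2_eq0; apply/eqP; rewrite eq_le norm2_ge0 andbT.
  apply/ler_addgt0Pl => e e0; rewrite addr0.
  have e2 : 0 < e / 2 by rewrite divr_gt0.
  have K1 : 0 < `|K| + 1 by rewrite ltr_wpDl.
  have [M _ hM] := (cvgr0Pnorm_lt _).1 pu0 _ e2.
  have [k Mk kl] := ul (e / 2 / (`|K| + 1)) (divr_gt0 e2 K1) M.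
  have := hM k Mk; rewrite /= ger0_norm ?norm2_ge0// => pk.
  rewrite -[p l](subrK (p (u k))); apply: le_trans (norm2_triangle _ _) _.
  have h1 := lip l (u k); rewrite norm2B ltr_pdivlMr// in kl.
  have h2 : K * norm2 (l - u k) <= (`|K| + 1) * norm2 (l - u k).
    by rewrite ler_wpM2r ?norm2_ge0//; have := ler_norm K; lra.
  by rewrite mulrC in kl; lra.
exists l; split => //; apply/cvgr0Pnorm_lt => e e0.
(* The level a is chosen with 2 a <= (e / 2) ^ 2, and (2 (a / 2)) ^ 2 <= a. *)
have eta0 : 0 < Num.min e (e ^+ 2 / 8).
  by rewrite lt_min e0 divr_gt0// exprn_gt0.
pose i := Num.truncn (Num.min e (e ^+ 2 / 8))^-1.
set a := (i.+1%:R^-1 : R).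
have a0 : 0 < a by rewrite invr_gt0.
have a1 : a <= 1 by rewrite invf_le1 ?ler1n.
have : a < Num.min e (e ^+ 2 / 8).
  by rewrite invf_plt ?posrE//; exact: truncnS_gt.
rewrite lt_min => /andP[ae ae2].
have a2 : 0 < a / 2 by rewrite divr_gt0.
have [j jl] := dense l _ pl a2.
have [|M hM] := nocross j i.
  move=> M; have [k Mk kl] := ul _ a2 M; exists k => //.
  have : norm2 (u k - q j) <= a.
    rewrite -[u k](subrK l) -addrA; apply: le_trans (norm2_triangle _ _) _.
    by rewrite (norm2B l); lra.
  move=> /(lerXn2r 2 (norm2_ge0 _) (ltW a0)) /le_trans; apply.
  by rewrite expr2 ger_pMl.
exists M => // k /= Mk; rewrite ger0_norm ?norm2_ge0//.
have kq : norm2 (u k - q j) < e / 2.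
  rewrite -ltr_sqr ?nnegrE ?norm2_ge0 ?(ltW (divr_gt0 _ _))//.
  by apply: lt_le_trans (hM k Mk) _; rewrite -/a; lra.
rewrite -[u k](subrK (q j)) -addrA; apply: le_lt_trans (norm2_triangle _ _) _.
lra.
Qed.

(** The upper limit agrees with the limit where the latter exists and is measurable
everywhere. *)
Definition limit_coord (R : realType) (T : Type) (u : nat -> T -> R) (w : T) : R :=
  fine (limn_esup (fun k => (u k w)%:E)).

Lemma measurable_limit_coord (R : realType) n (disp : measure_display)
    (T : measurableType disp) (P : probability T R) (I : nat -> T -> 'I_n)
    (hunif : forall k, uniform_draw P (I k)) (G : nat -> seq 'I_n -> R) :
  measurable_fun setT (limit_coord (fun k w => G k (history I k w))).
Proof.
apply: measurableT_comp; first exact: fine_measurable.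
apply: measurable_fun_limn_esup => k; apply/measurable_EFinP.
exact: (measurable_fun_history hunif).
Qed.

Lemma limit_coordE (R : realType) (T : Type) (u : nat -> T -> R) w l :
  u k w @[k --> \oo] --> l -> limit_coord u w = l.
Proof.
move=> ul; rewrite /limit_coord.
have uE : (u k w)%:E @[k --> \oo] --> l%:E by apply: cvg_comp ul _.
rewrite is_cvg_limn_esupE; last by apply/cvg_ex; exists l%:E.
by rewrite (cvg_lim _ uE).
Qed.

Section StochasticFixedPoint.
Context {R : realType} {d n : nat}.
Hypothesis hn : (0 < n)%N.
Context {disp : measure_display} {T : measurableType disp} (P : probability T R).
Variable I : nat -> T -> 'I_n.
Hypothesis hunif : forall k, uniform_draw P (I k).
Hypothesis hindep : independent_draws P I.

Variables (p : 'M[R]_(n, d) -> 'M[R]_(n, d)) (K kappa : R).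
Variable step : 'I_n -> 'M[R]_(n, d) -> 'M[R]_(n, d).
Hypothesis kappa_gt0 : 0 < kappa.
Hypothesis p_lip : forall x y, norm2 (p x - p y) <= K * norm2 (x - y).
Hypothesis p_zero : exists z, p z = 0.
Hypothesis step_descent : forall z zs, p zs = 0 ->
  n%:R^-1 * \sum_i norm2 (step i z - zs) ^+ 2 <=
  norm2 (z - zs) ^+ 2 - kappa * norm2 (p z) ^+ 2.
Variable z0 : 'M[R]_(n, d).

Let z (k : nat) (w : T) := trajectory step z0 (history I k w).

Lemma ae_residual_norm_cvg0 :
  {ae P, forall w, norm2 (p (z k w)) @[k --> \oo] --> (0 : R)}.
Proof.
have [zs pzs] := p_zero.
have := ae_residual_cvg0 hn hunif hindep z0 (fun x => sqr_ge0 (norm2 (x - zs)))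
  (fun x => sqr_ge0 (norm2 (p x))) kappa_gt0 (fun x => step_descent x pzs).
apply: filterS => w res0.
rewrite (_ : (fun k => _) = fun k => Num.sqrt (norm2 (p (z k w)) ^+ 2)); last first.
  by apply/funext => k; rewrite sqrtr_sqr ger0_norm ?norm2_ge0.
rewrite -(sqrtr0 R); apply: (cvg_comp _ _ res0).
exact: sqrt_continuous.
Qed.

(** The smallest of k + 1 expected squared residuals is at most their average, and
their sum is bounded. *)
Lemma min_expected_residual : exists C : R, \forall k \near \oo,
  (\big[mine/+oo]_(i < k.+1) 'E_P[fun w => (norm2 (p (z i w)) ^+ 2)%R]
     <= (C / k%:R)%:E)%E.
Proof.
have [zs pzs] := p_zero.
pose C := norm2 (z0 - zs) ^+ 2 / kappa.
pose e k := avg k (fun s => norm2 (p (trajectory step z0 s)) ^+ 2).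
have EE k : ('E_P[fun w => (norm2 (p (z k w)) ^+ 2)%R] = (e k)%:E)%E.
  rewrite unlock; apply: (integral_history hn hunif hindep k
    (G := fun s => norm2 (p (trajectory step z0 s)) ^+ 2)) => s.
  exact: sqr_ge0.
have C0 : 0 <= C by rewrite divr_ge0 ?sqr_ge0// ltW.
exists C; exists 1%N => // k /= k1.
have k0 : 0 < k%:R :> R by rewrite ltr0n.
have : \sum_(i < k.+1) e i <= C.
  exact: (sum_avg_descent z0 (V := fun x => norm2 (x - zs) ^+ 2)
    (N := fun x => norm2 (p x) ^+ 2) (fun x => sqr_ge0 _)
    kappa_gt0 (fun x => step_descent x pzs)).
have [[i ei] _|none] := pselect (exists i : 'I_k.+1, e i <= C / k%:R).
  by apply: (bigmin_inf i) => //; rewrite EE lee_fin.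
move=> sumC; exfalso.
have : \sum_(i < k.+1) (C / k%:R) < \sum_(i < k.+1) e i.
  apply: ltr_sum; first by apply/hasP; exists ord0; rewrite ?mem_index_enum.
  by move=> i _; rewrite ltNge; apply/negP => ei; apply: none; exists i.
rewrite sumr_const card_ord => /lt_le_trans /(_ sumC).
rewrite -[_ *+ _]mulr_natl ltNge => /negP; apply.
rewrite mulrCA ler_peMr// ler_pdivlMr// mul1r ler_nat//.
Qed.

(** The almost sure statements are needed at once for all zeros of p, possibly an
uncountable family; a countable dense set of zeros and the levels 1 / (i + 1)
suffice. *)
Lemma ae_iterates_cvg : {ae P, forall w, exists l, p l = 0 /\
  norm2 (z k w - l) @[k --> \oo] --> (0 : R)}.
Proof.
have [zs pzs] := p_zero.
have [q [pq dense]] := countable_dense_zeros pzs.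
have cross : {ae P, forall w, forall j i : nat,
    (forall M, exists2 k, (M <= k)%N & norm2 (z k w - q j) ^+ 2 <= i.+1%:R^-1) ->
    exists M, forall k, (M <= k)%N -> norm2 (z k w - q j) ^+ 2 < 2 * i.+1%:R^-1}.
  apply: ae_foralln => j; apply: ae_foralln => i.
  apply: (ae_crossing hn hunif hindep z0 (fun x => sqr_ge0 (norm2 (x - q j)))
    (fun x => sqr_ge0 (norm2 (p x))) kappa_gt0 (fun x => step_descent x (pq j))).
  by rewrite invr_gt0.
have bnd := ae_frequently_bounded hn hunif hindep z0
  (fun x => sqr_ge0 (norm2 (x - q 0%N)))
  (fun x => sqr_ge0 (norm2 (p x))) kappa_gt0 (fun x => step_descent x (pq 0%N)).
apply: filterS (filterI cross (filterI bnd ae_residual_norm_cvg0)) => w [cw [bw rw]].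
exact: (cvg_of_no_crossing p_lip rw dense bw cw).
Qed.

Variables (alpha : R) (sol : set 'rV[R]_d).
Variables (xh : 'M[R]_(n, d) -> 'rV[R]_d) (xn : 'M[R]_(n, d) -> 'I_n -> 'rV[R]_d).
Hypothesis xh_lip : forall x y, norm2 (xh x - xh y) <= norm2 (x - y).
Hypothesis xnE : forall z i, xn z i = xh z - alpha *: row i (p z).
Hypothesis p_zero_sol : forall z, p z = 0 -> sol (xh z).

Lemma ae_iterates_limits :
  exists (zstar : T -> 'M[R]_(n, d)) (xstar : T -> 'rV[R]_d),
    [/\ forall i j, measurable_fun [set: T] (fun w => zstar w i j),
        forall j, measurable_fun [set: T] (fun w => xstar w 0 j)
      & {ae P, forall w,
          [/\ p (zstar w) = 0, sol (xstar w),
              z k w @[k --> \oo] --> zstar w,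
              xh (z k w) @[k --> \oo] --> xstar w
            & forall i : 'I_n, xn (z k w) i @[k --> \oo] --> xstar w]}].
Proof.
exists (fun w => \matrix_(i, j) limit_coord (fun k w => z k w i j) w).
exists (fun w => \row_j limit_coord (fun k w => xh (z k w) 0 j) w).
split.
- move=> i j; under eq_fun do rewrite mxE.
  exact: (measurable_limit_coord hunif (fun _ s => trajectory step z0 s i j)).
- move=> j; under eq_fun do rewrite mxE.
  exact: (measurable_limit_coord hunif (fun _ s => xh (trajectory step z0 s) 0 j)).
have res0 := ae_residual_norm_cvg0.
have lim := ae_iterates_cvg.
apply: filterS (filterI res0 lim) => w [pw [l [pl zl]]].
have xl : norm2 (xh (z k w) - xh l) @[k --> \oo] --> (0 : R).
  apply: (cvg_norm2_lipschitz (K := 1)) zl => x y; rewrite mul1r; exact: xh_lip.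
have -> : \matrix_(i, j) limit_coord (fun k w => z k w i j) w = l.
  by apply/matrixP => i j; rewrite mxE; apply: limit_coordE; exact: cvg_coord_of_norm2.
have -> : \row_j limit_coord (fun k w => xh (z k w) 0 j) w = xh l.
  by apply/rowP => j; rewrite mxE; apply: limit_coordE; exact: cvg_coord_of_norm2.
split; [exact: pl|exact: p_zero_sol|exact: cvg_mx_of_norm2|exact: cvg_mx_of_norm2|].
move=> i; apply: cvg_mx_of_norm2.
apply: (squeeze_cvgr (f := fun=> 0)
  (h := fun k => norm2 (xh (z k w) - xh l) + `|alpha| * norm2 (p (z k w)))).
- apply: nearW => k; rewrite norm2_ge0/= xnE addrAC.
  apply: le_trans (norm2_triangle _ _) _.
  by rewrite lerD2l norm2N norm2Z ler_wpM2l// norm2_row_le.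
- exact: cvg_cst.
- rewrite -(addr0 0); apply: cvgD => //; rewrite -(mulr0 `|alpha|).
  by apply: cvgM => //; exact: cvg_cst.
Qed.

End StochasticFixedPoint.

(** * The stochastic proximal-proximal-gradient method *)

Lemma row_sppg_step (R : realType) d n (r : 'rV[R]_d -> \bar R)
    (f g : 'I_n -> 'rV[R]_d -> \bar R) (alpha : R) i (z : 'M[R]_(n, d)) j :
  0 < alpha -> row j (sppg_step alpha r f g i z) =
  if j == i then row j z - alpha *: row j (p_map alpha r f g z) else row j z.
Proof.
move=> a0; rewrite rowK rowK; case: ifP => // _.
by rewrite scalerA mulfV ?gt_eqF// scale1r opprB addrA.
Qed.

Lemma sppg_trajectory (R : realType) d n (r : 'rV[R]_d -> \bar R)
    (f g : 'I_n -> 'rV[R]_d -> \bar R) (alpha : R) z0 (T : Type)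
    (I : nat -> T -> 'I_n) k w :
  sppg alpha r f g z0 (fun j => I j w) k =
  trajectory (sppg_step alpha r f g) z0 (history I k w).
Proof.
elim: k => [//|k IH].
by rewrite historyS trajectory_rcons -IH.
Qed.

Theorem theorem5 (R : realType) (d n : nat) (hn : (0 < n)%N)
  (r : 'rV[R]_d -> \bar R) (f g : 'I_n -> 'rV[R]_d -> \bar R)
  (hr : ccp r) (hf : forall i, ccp (f i)) (hg : forall i, ccp (g i))
  (L : R) (hL : 0 < L)
  (hfdiff : forall i, edifferentiable (f i))
  (hflip : forall i, lipschitz_grad L (f i))
  (hsaddle : exists x xs nu, saddle_point r f g x xs nu)
  (alpha : R) (halpha : 0 < alpha < 3 / (2 * L))
  (disp : measure_display) (T : measurableType disp) (P : probability T R)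
  (I : nat -> T -> 'I_n)
  (hunif : forall k, uniform_draw P (I k)) (hindep : independent_draws P I)
  (z0 : 'M[R]_(n, d)) :
  let z (k : nat) (w : T) := sppg alpha r f g z0 (fun j => I j w) k in
  let p := p_map alpha r f g in
  [/\ {ae P, forall w, norm2 (p (z k w)) @[k --> \oo] --> (0 : R)},
      exists C : R, \forall k \near \oo,
        (\big[mine/+oo]_(i < k.+1) 'E_P[fun w => (norm2 (p (z i w)) ^+ 2)%R]
         <= (C / k%:R)%:E)%E
    & exists (zstar : T -> 'M[R]_(n, d)) (xstar : T -> 'rV[R]_d),
      [/\ forall i j, measurable_fun [set: T] (fun w => zstar w i j),
          forall j, measurable_fun [set: T] (fun w => xstar w 0 j)
        & {ae P, forall w,
            [/\ p (zstar w) = 0,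
                argmin (objective r f g) (xstar w),
                z k w @[k --> \oo] --> zstar w,
                xhalf alpha r (z k w) @[k --> \oo] --> xstar w
              & forall i : 'I_n,
                  xnext alpha r f g (z k w) i @[k --> \oo] --> xstar w]}]].
Proof.
move=> z p.
have /andP[a0 aL] := halpha.
have aL2 : alpha * L < 2.
  have L2 : 0 < 2 * L by rewrite mulr_gt0.
  by move: aL; rewrite ltr_pdivlMr//; lra.
have hfconv i : econvex (f i) by have [] := hf i.
have n0 : 0 < n%:R :> R by rewrite ltr0n.
have xhS (y : 'M[R]_(n, d)) := prox_subgrad (tuple_mean y) a0 hr.
have xnS (y : 'M[R]_(n, d)) i := prox_subgrad
  (2 *: xhalf alpha r y - row i y - alpha *: grad (f i) (xhalf alpha r y)) a0 (hg i).
have rowp (y : 'M[R]_(n, d)) i :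
    row i (p y) = alpha^-1 *: (xhalf alpha r y - xnext alpha r f g y i).
  by rewrite rowK.
have rowS (i : 'I_n) (y : 'M[R]_(n, d)) j := row_sppg_step r f g i y j a0.
have plip := p_map_lipschitz hn hL a0 hfconv hfdiff hflip xhS xnS rowp aL2.
have xlip := xhalf_lipschitz a0 xhS.
have pzero := saddle_point_fixed_point hn a0 hr hg hfdiff hflip hsaddle.
have desc := sppg_step_descent hn hL a0 hfconv hfdiff hflip xhS xnS rowp rowS.
have xnE (y : 'M[R]_(n, d)) i :
    xnext alpha r f g y i = xhalf alpha r y - alpha *: row i (p y).
  by rewrite rowp scalerA mulfV ?gt_eqF// scale1r opprB addrC subrK.
have kappa0 : 0 < alpha ^+ 2 * (1 - alpha * L / 2) / n%:R.
  by rewrite divr_gt0// mulr_gt0 ?exprn_gt0//; lra.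
have psol (y : 'M[R]_(n, d)) : p y = 0 ->
    argmin (objective r f g) (xhalf alpha r y).
  move=> py; apply: (fixed_point_argmin hn a0 hfconv hfdiff hflip (xhS y)).
  move=> i; have := xnS y i; rewrite -/(xnext alpha r f g y i).
  by rewrite xnE py row0 scaler0 subr0.
have -> : z = fun k w => trajectory (sppg_step alpha r f g) z0 (history I k w).
  by apply/funext => k; apply/funext => w; exact: sppg_trajectory.
split.
- exact: (ae_residual_norm_cvg0 hn hunif hindep kappa0 pzero desc z0).
- exact: (min_expected_residual hn hunif hindep kappa0 pzero desc z0).
- exact: (ae_iterates_limits hn hunif hindep kappa0 plip pzero desc z0 xlip xnE psol).
Qed.
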